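(* Let $X$ be a polygon with $n\ge 3$ vertices (regarded as a two-dimensional cell complex including its 2-cell). a. If the number of vertices is odd, $n=2r+1$, then for every object in $\mathrm{CM}_\dagger(X)$ the associated family $\mathcal F$ consists of all strings of length $r$. Hence, up to isomorphism, there is only one object in $\mathrm{CM}_\dagger(X)$, and this is the only maximal monomial labelling of $X$ (i.e. maximal object of $\mathrm{CM}(X)$), up to isomorphism. b. If the number of vertices is even, there are no monomial labellings of $X$ giving a minimal cellular resolution of an ideal of codimension three with Cohen-Macaulay quotient ring, i.e. $\mathrm{CM}(X)$ is empty.
   Context: Label the vertices of $X$ cyclically by $V=\{0,1,\dots,n-1\}$. A string $[i,j]$ is the set of vertices obtained by starting at $i$ and increasing by one at each step modulo $n$ until reaching $j$; its length is the number of vertices in it. Fix a field $k$; $\mathbb N$ contains $0$. Identify $k[x_1,\dots,x_r]$ with $k[\mathbb N^r]$. An object of $\mathrm{CM}(X)$ is a pair $(\mathbb N^r,\mathbf a)$, with $\mathbf a=(\mathbf a_v)_{v\in V}$ a tuple of elements of $\mathbb N^r$, i.e. monomials $m_v=\mathbf x^{\mathbf a_v}$ in $S=k[x_1,\dots,x_r]$, none dividing another, such that $S/(m_v: v\in V)$ is Cohen-Macaulay of codimension $\dim X+1=3$ and the cellular complex of $X$ labelled by the $m_v$ is a minimal free resolution of $S/(m_v:v\in V)$. Here each face $F$ (including the empty face) is labelled by the least common multiple $m_F$ of the labels of its vertices, and the cellular complex has a free generator $e_F$ in homological degree $\dim F+1$ for each face $F$, with differential $e_F\mapsto\sum_G\mathrm{sign}(G,F)\frac{m_F}{m_G}e_G$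 over the codimension one faces $G$ of $F$, $\mathrm{sign}$ being an incidence function. A morphism $(\mathbb N^r,\mathbf a)\to(\mathbb N^s,\mathbf b)$ is a semigroup (monoid) homomorphism $\phi:\mathbb N^r\to\mathbb N^s$ with $\phi(\mathbf a_v)=\mathbf b_v$ for all $v$. An object of $\mathrm{CM}(X)$ is maximal if for every morphism $\phi:(\mathbb N^s,\mathbf b)\to(\mathbb N^r,\mathbf a)$ in $\mathrm{CM}(X)$ to it, $\phi$ is surjective and there is a splitting, i.e. a morphism $\psi:(\mathbb N^r,\mathbf a)\to(\mathbb N^s,\mathbf b)$ with $\phi\circ\psi=\mathrm{id}$. For an object with square free monomials, associate to each variable $x_p$ the set $V_p\subseteq V$ of all $v$ such that $x_p$ divides $m_v$. $\mathrm{CM}_*(X)$ is the full subcategory of $\mathrm{CM}(X)$ of objects with square free monomials whose sets $V_p$ are pairwise distinct; the associated family is $\mathcal F=\{V_p\}$. $\mathrm{CM}_\dagger(X)$ is the full subcategory of $\mathrm{CM}_*(X)$ of objects such that for every $S\in\mathcal F$ the restriction of $X$ to $S$ (the subcomplex of faces all of whose vertices lie in $S$) is connected, in particular nonempty. *)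

(* Defs.v *)
From HB Require Import structures.
From mathcomp Require Import all_boot all_order all_algebra.
From mathcomp Require Import ring_quotient.
From mathcomp Require Export mpoly.
Set Implicit Arguments.
Unset Strict Implicit.
Unset Printing Implicit Defensive.
Import GRing.Theory.
Local Open Scope ring_scope.

(* Polynomials have their coefficients in a field k; an ideal of              *)
(* S = k[x_1, ..., x_r] is given by a finite list gs of generators, and the   *)
(* ring S/(gs) is handled through S: its primes are the primes of S that      *)
(* contain gs.                                                                *)

Definition max_nat (P : nat -> Prop) (d : nat) :=
  P d /\ forall e, P e -> (e <= d)%N.

Definition min_nat (P : nat -> Prop) (d : nat) :=
  P d /\ forall e, P e -> (d <= e)%N.

Section Ideals.
Variables (k : fieldType) (r : nat).
Local Notation S := {mpoly k[r]}.
Implicit Types (gs fs : seq S) (P : {pred S}).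

Definition in_ideal gs (f : S) : Prop :=
  exists c : nat -> S, f = \sum_(i < size gs) c i * gs`_i.

(* idealr_closed P includes 1 \notin P.                                       *)
Definition prime_ideal P : Prop := idealr_closed P /\ prime_idealr_closed P.

Definition prime_chain gs (d : nat) (c : nat -> {pred S}) : Prop :=
  [/\ forall i, (i <= d)%N -> prime_ideal (c i),
      forall i, (i <= d)%N -> {in gs, forall g, g \in c i} &
      forall i, (i < d)%N ->
        {subset c i <= c i.+1} /\ exists2 f, f \in c i.+1 & f \notin c i].

Definition krull_dim gs : nat -> Prop :=
  max_nat (fun d => exists c, prime_chain gs d c).

Definition height P : nat -> Prop :=
  max_nat (fun d => exists2 c, prime_chain [::] d c & c d =i P).

Definition codim gs : nat -> Prop :=
  min_nat (fun h => exists P,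
    [/\ prime_ideal P, {in gs, forall g, g \in P} & height P h]).

Definition regular_seq gs fs : Prop :=
  (forall i h, (i < size fs)%N ->
     in_ideal (gs ++ take i fs) (fs`_i * h) -> in_ideal (gs ++ take i fs) h)
  /\ ~ in_ideal (gs ++ fs) 1.

(* Depth of S/(gs) with respect to the graded maximal ideal (x_1, ..., x_r),  *)
(* i.e. the polynomials without constant term.                                *)
Definition depth gs : nat -> Prop :=
  max_nat (fun d => exists fs,
    [/\ size fs = d, {in fs, forall f, f@_0%MM = 0} & regular_seq gs fs]).

(* The Cohen-Macaulay property for a graded quotient S/(gs), gs homogeneous.  *)
Definition cohen_macaulay gs : Prop :=
  exists2 d, depth gs d & krull_dim gs d.

End Ideals.

(* cell X d is the set of faces of dimension d - 1, so that the index d is    *)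
(* the homological degree; the only element of cell X 0 is the empty face.    *)
Record cell_complex (n : nat) := CellComplex {
  cell : nat -> finType;
  verts : forall d, cell d -> {set 'I_n};
  sign : forall d, cell d -> cell d.+1 -> int
}.

Definition incidence_function (n : nat) (X : cell_complex n) : Prop :=
  [/\ forall d (G : cell X d) (F : cell X d.+1),
        if verts G \subset verts F then sign G F = 1 \/ sign G F = -1
        else sign G F = 0,
      forall (E : cell X 0) (v : cell X 1), sign E v = 1 &
      forall d (H : cell X d) (F : cell X d.+2),
        \sum_(G : cell X d.+1) sign H G * sign G F = 0].

(* A tuple of monomials in lvars variables, indexed by the vertices.          *)
Record labelling (n : nat) := Labelling {
  lvars : nat;
  lab : 'I_n -> 'X_{1..lvars}
}.

Section CellularComplex.
Variables (k : fieldType) (n : nat) (X : cell_complex n) (A : labelling n).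
Local Notation S := {mpoly k[lvars A]}.

Definition lab_gens : seq S := [seq 'X_[lab A v] | v <- enum 'I_n].

Definition face_lab d (F : cell X d) : 'X_{1..lvars A} :=
  \big[@mlcm _/0%MM]_(v in verts F) lab A v.

Definition bd_coef d (G : cell X d) (F : cell X d.+1) : S :=
  (sign G F)%:~R * 'X_[face_lab F - face_lab G].

Definition bd d (z : {ffun cell X d.+1 -> S}) : {ffun cell X d -> S} :=
  [ffun G => \sum_F bd_coef G F * z F].

(* In homological degree 0 the cokernel of the differential is S/(lab_gens).  *)
Definition cellular_resolution : Prop :=
  (forall (f : S), in_ideal lab_gens f <->
     exists z : {ffun cell X 1 -> S}, bd z = [ffun=> f])
  /\ forall d (z : {ffun cell X d.+1 -> S}),
     bd z = 0 <-> exists w : {ffun cell X d.+2 -> S}, z = bd w.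

Definition cellular_minimal : Prop :=
  forall d (G : cell X d) (F : cell X d.+1), (bd_coef G F)@_0%MM = 0.

End CellularComplex.

Section Category.
Variables (k : fieldType) (n : nat).
Implicit Types (A B : labelling n).

(* Objects of CM(X) for X of dimension 2.                                     *)
Definition CM (X : cell_complex n) A : Prop :=
  [/\ forall u v, u != v -> ~~ (lab A u <= lab A v)%MM,
      cohen_macaulay (lab_gens k A),
      codim (lab_gens k A) 3,
      cellular_resolution k X A &
      cellular_minimal k X A].

Definition morphism A B (phi : 'X_{1..lvars A} -> 'X_{1..lvars B}) : Prop :=
  [/\ phi 0%MM = 0%MM,
      forall u v, phi (u + v)%MM = (phi u + phi v)%MM &
      forall v, phi (lab A v) = lab B v].

Definition isomorphic A B : Prop :=
  exists phi psi, [/\ @morphism A B phi, @morphism B A psi,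
    cancel phi psi & cancel psi phi].

Definition maximal (X : cell_complex n) A : Prop :=
  CM X A /\ forall B phi, CM X B -> @morphism B A phi ->
    (forall a, exists b, phi b = a)
    /\ exists2 psi, @morphism A B psi & cancel psi phi.

Definition squarefree A : Prop := forall v p, (lab A v p <= 1)%N.

Definition var_set A (p : 'I_(lvars A)) : {set 'I_n} :=
  [set v | (0 < lab A v p)%N].

Definition var_family A : {set {set 'I_n}} := [set var_set p | p : 'I_(lvars A)].

Definition CM_star (X : cell_complex n) A : Prop :=
  [/\ CM X A, squarefree A & injective (@var_set A)].

Definition edge_in (X : cell_complex n) (W : {set 'I_n}) : rel 'I_n :=
  fun u v => [exists e : cell X 2,
    (verts e == [set u; v]) && (verts e \subset W)].

(* A cell complex is connected iff it is nonempty and any two vertices are    *)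
(* joined by a path of edges.                                                 *)
Definition connected_restriction (X : cell_complex n) (W : {set 'I_n}) : Prop :=
  W != set0 /\ {in W &, forall u v, connect (edge_in X W) u v}.

Definition CM_dagger (X : cell_complex n) A : Prop :=
  CM_star X A /\ {in var_family A, forall W, connected_restriction X W}.

End Category.

Section Polygon.
Variable n : nat.

Definition polygon_cell (d : nat) : finType :=
  match d with
  | 0 => unit
  | 1 => 'I_n
  | 2 => 'I_n
  | 3 => unit
  | _ => void
  end.

(* The edge with index i joins i and i + 1 modulo n.                          *)
Definition polygon_verts d : polygon_cell d -> {set 'I_n} :=
  match d with
  | 0 => fun=> set0
  | 1 => fun v => [set v]
  | 2 => fun i => [set i; ordS i]
  | _ => fun=> setT
  end.

Definition polygon_sign d : polygon_cell d -> polygon_cell d.+1 -> int :=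
  match d with
  | 0 => fun _ _ => 1
  | 1 => fun v i => (v == ordS i)%:Z - (v == i)%:Z
  | 2 => fun _ _ => 1
  | _ => fun _ _ => 0
  end.

Definition polygon : cell_complex n :=
  @CellComplex n polygon_cell polygon_verts polygon_sign.

Lemma polygon_incidence : (2 < n)%N -> incidence_function polygon.
Proof.
move=> n_gt2.
have neqS (i : 'I_n) : (i == ordS i) = false.
  apply/negP=> /eqP/(congr1 val)/=; case: i => i /= ltin.
  case: (ltngtP i.+1 n) => [lt|gt|eq].
  - by rewrite modn_small // => /eqP; rewrite ltn_eqF.
  - by rewrite ltnNge ltin in gt.
  by rewrite eq modnn => i0; rewrite -eq i0 in n_gt2.
have sum_eq (j : 'I_n) : \sum_i (i == j)%:Z = 1.
  rewrite (bigD1 j) //= eqxx big1 ?addr0 // => i /negPf -> //.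
split=> [d G F|//|d H F] /=.
- case: d G F => [|[|[|[|d]]]] //= G F.
  + by rewrite sub0set; left.
  + rewrite sub1set !inE; case: (eqVneq G F) => [->|_] /=.
      by rewrite neqS; right.
    by case: eqP => // _; left.
  by rewrite subsetT; left.
case: d H F => [|[|[|d]]] //= H F.
- under eq_bigr do rewrite mul1r.
  by rewrite sumrB !sum_eq subrr.
under eq_bigr do rewrite mulr1.
rewrite sumrB (eq_bigr (fun i => (i == ord_pred H)%:Z)); last first.
  by move=> i _; rewrite -(inj_eq (@ordS_inj n)) ord_predK eq_sym.
rewrite [X in _ - X](eq_bigr (fun i => (i == H)%:Z)) ?sum_eq ?subrr //.
by move=> i _; rewrite eq_sym.
Qed.

(* The string [i, j].                                                         *)
Definition string (i j : 'I_n) : {set 'I_n} :=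
  [set v : 'I_n | ((v + n - i) %% n <= (j + n - i) %% n)%N].

Definition strings_of_length (l : nat) : {set {set 'I_n}} :=
  [set string ij.1 ij.2 | ij in [pred ij : 'I_n * 'I_n |
     #|string ij.1 ij.2| == l]].

End Polygon.

(* Main.v *)
Require Import Defs.
From mathcomp Require Import all_boot all_order all_algebra.
From mathcomp Require Import ring_quotient zify ring.

(** For a labelling (m_v) of the polygon, put
    V_(p,t) = {v | t < exponent of x_p in m_v}.  The resolution is exact iff
    the complement of every union of sets V_(p,t) is a string (or empty, or
    everything); codimension three says that no two of them cover the polygon.
    If S ends at i and T starts at i + 2, then S :|: T misses exactly i + 1, so
    |S| + |T| >= n - 1; if T starts at i + 1, then S :|: T is a proper string,
    so |S| + |T| <= n - 1.  Going once around the polygon, all the V_(p,t) have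
    the same length r with 2r = n - 1, and they are all strings of length r.
    Hence every object receives a canonical morphism from the labelling by
    strings of length r, which splits every morphism in the other direction.

    That this labelling is Cohen-Macaulay of codimension three is proved without
    homological algebra.  Any d + 1 polynomials are algebraically dependent
    modulo a squarefree monomial ideal whose faces have at most d elements; the
    lexicographically least term of the relation bounds both the length of
    chains of primes (Coquand-Lombardi) and the length of regular sequences.
    The elementary symmetric polynomials e_(n-3), ..., e_1 are regular modulo
    any three variables, and vertex decomposition carries this over to the
    ideal of strings. *)

Set Implicit Arguments.
Unset Strict Implicit.
Unset Printing Implicit Defensive.
Import GRing.Theory.

Local Open Scope ring_scope.

(** * Weakly regular sequences and monomial ideals *)

Section WeaklyRegular.
Variable S : comNzRingType.
Implicit Types (J K : S -> Prop) (fs : seq S) (f g h : S).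

Definition is_ideal J := J 0 /\ forall a u v, J u -> J v -> J (a * u + v).

Definition adjoin J f : S -> Prop := fun h => exists a, J (h - a * f).

(** Unlike in [regular_seq], the last quotient may vanish; the unit ideal serves as base case of the
    inductions below. *)
Fixpoint wreg J fs : Prop :=
  if fs is f :: fs' then (forall h, J (f * h) -> J h) /\ wreg (adjoin J f) fs'
  else True.

Lemma is_idealD J u v : is_ideal J -> J u -> J v -> J (u + v).
Proof. by case=> _ idJ Ju Jv; rewrite -[u]mul1r; apply: idJ. Qed.

Lemma is_idealM J a u : is_ideal J -> J u -> J (a * u).
Proof. by case=> J0 idJ Ju; rewrite -[_ * _]addr0; apply: idJ. Qed.

Lemma is_idealN J u : is_ideal J -> J u -> J (- u).
Proof. by move=> idJ Ju; rewrite -mulN1r; apply: is_idealM. Qed.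

Lemma is_idealB J u v : is_ideal J -> J u -> J v -> J (u - v).
Proof. by move=> idJ Ju Jv; apply: is_idealD => //; apply: is_idealN. Qed.

Lemma is_ideal_sum J (I : Type) (r : seq I) (P : pred I) (F : I -> S) :
  is_ideal J -> (forall i, P i -> J (F i)) -> J (\sum_(i <- r | P i) F i).
Proof.
move=> idJ JF; apply: (big_ind J) => //; first by case: idJ.
by move=> u v; apply: is_idealD.
Qed.

Lemma adjoin_ideal J f : is_ideal J -> is_ideal (adjoin J f).
Proof.
move=> idJ; split; first by exists 0; rewrite mul0r subr0; case: idJ.
move=> a u v [b Jb] [c Jc]; exists (a * b + c).
have -> : a * u + v - (a * b + c) * f = a * (u - b * f) + (v - c * f) by ring.
by case: idJ => _; apply.
Qed.

Lemma adjoin_sub J f h : J h -> adjoin J f h.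
Proof. by exists 0; rewrite mul0r subr0. Qed.

Lemma adjoin_mem J f : is_ideal J -> adjoin J f f.
Proof. by case=> J0 _; exists 1; rewrite mul1r subrr. Qed.

Lemma adjoin_ext J K f :
  (forall h, J h <-> K h) -> forall h, adjoin J f h <-> adjoin K f h.
Proof. by move=> JK h; split=> -[a /JK]; exists a. Qed.

Lemma wreg_ext fs J K : (forall h, J h <-> K h) -> wreg J fs -> wreg K fs.
Proof.
elim: fs J K => //= f fs IH J K JK [regf regfs]; split.
  by move=> h /JK/regf/JK.
by apply: IH regfs; apply: adjoin_ext.
Qed.

(* Multiplication by g identifies S/(J : g) with the kernel of S/J ->         *)
(* S/(J + (g)), so regularity on both ends passes to the middle.              *)
Lemma wreg_colon fs J K g : is_ideal J -> (forall h, K h <-> J (g * h)) ->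
  wreg K fs -> wreg (adjoin J g) fs -> wreg J fs.
Proof.
elim: fs J K => //= f fs IH J K idJ KE [regK regsK] [regJg regsJg].
have reg h : J (f * h) -> J h.
  move=> Jfh; have [|a Ja] := regJg h; first exact: adjoin_sub.
  have Ka : K a.
    apply: regK; apply/KE.
    have -> : g * (f * a) = f * h - f * (h - a * g) by ring.
    by apply: is_idealB => //; apply: is_idealM.
  have -> : h = (h - a * g) + g * a by ring.
  by apply: is_idealD => //; apply/KE.
(* The colon of J + (f) by [g] is K + (f): its elements lie in K + (f) because [f] is regular modulo
   J + (g). *)
split=> //; apply: (IH _ (adjoin K f) (adjoin_ideal f idJ)) => //.
  move=> h; split=> [[b /KE Jb]|[b Jb]].
    exists (g * b).
    by have -> : g * h - g * b * f = g * (h - b * f) by ring.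
  have [|c Jc] := regJg b.
    exists h; have -> : f * b - h * g = - (g * h - b * f) by ring.
    exact: is_idealN.
  exists c; apply/KE.
  have -> : g * (h - c * f) = (g * h - b * f) + f * (b - c * g) by ring.
  by apply: is_idealD => //; apply: is_idealM.
apply: wreg_ext regsJg => h; split=> -[b [a Jab]]; exists a; exists b.
  by have -> : h - a * g - b * f = h - b * f - a * g by ring.
by have -> : h - a * f - b * g = h - b * g - a * f by ring.
Qed.

Lemma wreg_full fs J : (forall h, J h) -> wreg J fs.
Proof. by elim: fs J => //= f fs IH J Jh; split=> //; apply: IH => h; exists 0. Qed.

End WeaklyRegular.

Section MonomialIdeals.
Variables (k : fieldType) (n : nat).
Local Notation S := {mpoly k[n]}.
Implicit Types (E : pred 'X_{1..n}) (f g h : S) (T Q : {set 'I_n}).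

Definition upclosed E := forall m m', E m -> E (m + m')%MM.

Definition mem_ideal (P : {pred S}) : S -> Prop := fun h => h \in P.

Definition mideal E : {pred S} := [pred f | all E (msupp f)].

Lemma midealP E f : reflect (forall m, ~~ E m -> f@_m = 0) (f \in mideal E).
Proof.
apply: (iffP allP) => [Ef m|Ef m].
  by apply: contraNeq; rewrite -mcoeff_msupp; apply: Ef.
by rewrite mcoeff_msupp; apply: contraR => /Ef ->.
Qed.

Lemma mideal_ext E E' : E =1 E' -> mideal E =i mideal E'.
Proof. by move=> EE f; rewrite !inE; apply: eq_all. Qed.

Lemma mideal_ideal E : upclosed E -> is_ideal (mem_ideal (mideal E)).
Proof.
move=> upE; split; first by rewrite /mem_ideal inE msupp0.
move=> a u v /allP Eu /allP Ev; apply/allP=> m /msuppD_le.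
rewrite mem_cat => /orP[/msuppM_le|/Ev //].
by case/allpairsP=> -[m1 m2] /= [_ m2u ->]; rewrite addmC; apply/upE/Eu.
Qed.

Lemma mideal_colonX E (i : 'I_n) h :
  ('X_i * h \in mideal E) = (h \in mideal (fun m => E (U_(i) + m)%MM)).
Proof.
rewrite !inE mulrC (perm_all _ (msuppMX h U_(i))) all_map.
by apply: eq_all.
Qed.

(** The terms of [h] outside [E] are all divisible by ['X_[g]], and their quotients add up to the
    coefficient of ['X_[g]]. *)
Lemma mideal_adjoin E (g : 'X_{1..n}) h : upclosed E ->
  adjoin (mem_ideal (mideal E)) 'X_[g] h <->
  h \in mideal (fun m => E m || (g <= m)%MM).
Proof.
move=> upE; split=> [[a /allP Ea]|/allP Eh].
  rewrite -[h](subrK (a * 'X_[g])); apply/allP=> m /msuppD_le.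
  rewrite mem_cat => /orP[/Ea -> //|].
  by rewrite (perm_mem (msuppMX _ _)) => /mapP[m' _ ->]; rewrite lem_addr orbT.
exists (\sum_(m <- msupp h | ~~ E m) h@_m *: 'X_[m - g]).
rewrite {1}[h]mpolyE mulr_suml (bigID E) /= -addrA -sumrB.
rewrite [X in _ + X]big1_seq ?addr0.
  have idE := mideal_ideal upE.
  apply: (is_ideal_sum _ idE) => m Em.
  rewrite -mul_mpolyC; apply: (is_idealM _ idE).
  by rewrite /mem_ideal inE msuppX /= Em.
move=> m /andP[Em /Eh]; rewrite (negPf Em) /= => gm.
by rewrite -scalerAl -mpolyXD submK // subrr.
Qed.

Definition msupport (m : 'X_{1..n}) : {set 'I_n} := [set i | (0 < m i)%N].

Lemma msupportD m1 m2 : msupport (m1 + m2)%MM = msupport m1 :|: msupport m2.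
Proof. by apply/setP=> i; rewrite !inE mnmDE addn_gt0. Qed.

Lemma msupport1 i : msupport U_(i)%MM = [set i].
Proof. by apply/setP=> j; rewrite !inE mnm1E lt0b eq_sym. Qed.

Lemma msupport_mesym1 T : msupport (mesym1 T) = T.
Proof. by apply/setP=> i; rewrite [LHS]inE mnmE; case: (i \in T). Qed.

Lemma mesym1_le T m : (mesym1 T <= m)%MM = (T \subset msupport m).
Proof.
apply/mnm_lepP/subsetP=> le i.
  by rewrite inE => iT; have := le i; rewrite mnmE iT.
by rewrite mnmE; case: (boolP (i \in T)) => // /le; rewrite inE.
Qed.

(* A squarefree monomial ideal is given by the set D of its nonfaces.         *)
Definition nonfaces (D : pred {set 'I_n}) :=
  forall U V : {set 'I_n}, D U -> D (U :|: V).

(** The Stanley-Reisner ideal of the simplicial complex formed by the sets outside [D]. *)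
Definition sqfree_ideal (D : pred {set 'I_n}) : {pred S} :=
  mideal (fun m => D (msupport m)).

Lemma nonfaces_upclosed D : nonfaces D -> upclosed (fun m => D (msupport m)).
Proof. by move=> upD m m'; rewrite msupportD; apply: upD. Qed.

Lemma sqfree_ideal_ext D D' : D =1 D' -> sqfree_ideal D =i sqfree_ideal D'.
Proof. by move=> DD; apply: mideal_ext => m. Qed.

Lemma sqfree_idealP D : nonfaces D -> is_ideal (mem_ideal (sqfree_ideal D)).
Proof. by move/nonfaces_upclosed/mideal_ideal. Qed.

(** Vertex decomposition at [i]: the colon by ['X_i] is the ideal of the star of [i], the sum with
    ['X_i] that of the deletion of [i], and [wreg_colon] joins the two. *)
Lemma sqfree_ideal_wreg D i fs : nonfaces D ->
  wreg (mem_ideal (sqfree_ideal (fun U => D (i |: U)))) fs ->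
  wreg (mem_ideal (sqfree_ideal (fun U => (i \in U) || D U))) fs ->
  wreg (mem_ideal (sqfree_ideal D)) fs.
Proof.
move=> upD rcolon radj.
have colonE h : (h \in sqfree_ideal (fun U => D (i |: U))) =
    ('X_i * h \in sqfree_ideal D).
  rewrite [RHS]mideal_colonX; apply: mideal_ext => m.
  by rewrite msupportD msupport1.
apply: (wreg_colon (g := 'X_i) _ _ rcolon); first exact: sqfree_idealP.
  by move=> h; rewrite /mem_ideal colonE.
apply: wreg_ext radj => h.
have adjE : h \in sqfree_ideal (fun U => (i \in U) || D U) =
    (h \in mideal (fun m => D (msupport m) || (U_(i) <= m)%MM)).
  by apply: mideal_ext => m; rewrite lep1mP inE orbC lt0n.
rewrite {1}/mem_ideal adjE.
by split=> /mideal_adjoin; apply; apply: nonfaces_upclosed.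
Qed.

End MonomialIdeals.

Arguments sqfree_ideal k {n} D.

(** * Primes generated by variables, and elementary symmetric polynomials *)

Section VariablePrimes.
Variables (k : fieldType) (n : nat).
Local Notation S := {mpoly k[n]}.
Implicit Types (f g h : S) (T Q U : {set 'I_n}).

Definition meets T : pred {set 'I_n} := fun U => T :&: U != set0.

Lemma meetsP T U : reflect (exists2 i, i \in T & i \in U) (meets T U).
Proof.
apply: (iffP (set0Pn _)) => [[i /setIP[iT iU]]|[i iT iU]]; exists i => //.
by rewrite inE iT.
Qed.

Lemma meets_nonfaces T : nonfaces (meets T).
Proof.
by move=> U V /meetsP[i iT iU]; apply/meetsP; exists i; rewrite // inE iU.
Qed.

Definition var_ideal T : {pred S} := sqfree_ideal k (meets T).

(** Setting the variables of [T] to zero is a ring morphism into a domain; its kernel is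
    [var_ideal T], which makes that ideal prime. *)
Lemma mcoeff_kill T f m :
  (mmap (@mpolyC n k) (fun i => if i \in T then 0 else 'X_i) f)@_m =
  if meets T (msupport m) then 0 else f@_m.
Proof.
pose h (i : 'I_n) : S := if i \in T then 0 else 'X_i.
have hE m' : mmap1 h m' = if meets T (msupport m') then 0 else 'X_[m'].
  case: meetsP => [[i iT]|disj].
    rewrite inE => mi; rewrite /mmap1 (bigD1 i) //= /h iT expr0n.
    by rewrite (gtn_eqF mi) mul0r.
  rewrite mpolyXE_id; apply: eq_bigr => i _; rewrite /h.
  case: ifP => // iT; case: (posnP (m' i)) => [->//|mi].
  by case: disj; exists i => //; rewrite inE.
rewrite /mmap -/h raddf_sum /= [in RHS](mpolyE f) raddf_sum /=.
case: ifP => [mT|mT].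
  apply: big1 => m' _; rewrite hE mul_mpolyC mcoeffZ.
  case: ifP => m'T; first by rewrite mcoeff0 mulr0.
  by rewrite mcoeffX; case: eqP m'T => [->|_]; rewrite ?mT // mulr0.
apply: eq_bigr => m' _; rewrite hE mul_mpolyC !mcoeffZ.
case: ifP => // m'T; rewrite mcoeffX mcoeff0.
by case: eqP m'T => [->|//]; rewrite mT.
Qed.

Lemma var_idealE T f : (f \in var_ideal T) =
  (mmap (@mpolyC n k) (fun i => if i \in T then 0 else 'X_i : S) f == 0).
Proof.
apply/midealP/eqP => [fT|kill0 m mT].
  apply/mpolyP=> m; rewrite mcoeff_kill mcoeff0.
  by case: ifP => // /negbT/fT.
by rewrite -(mcoeff0 _ m) -kill0 mcoeff_kill (negPf mT).
Qed.

Lemma var_ideal_prime T : prime_ideal (var_ideal T).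
Proof.
split; last by move=> u v; rewrite !var_idealE rmorphM mulf_eq0.
split; first by rewrite var_idealE mmap0.
  by rewrite var_idealE rmorph1 oner_eq0.
move=> a u v; rewrite !var_idealE => /eqP u0 /eqP v0.
by rewrite rmorphD rmorphM /= u0 v0 mulr0 addr0.
Qed.

Lemma var_idealX T m : ('X_[m] \in var_ideal T) = meets T (msupport m).
Proof. by rewrite inE msuppX /= andbT. Qed.

(** The ideal is generated by the variables in [T] and the product of those in [Q]. Decomposing at
    [q] in [Q], the colon drops [q] from the product and the sum is the prime of [q |: T]; an empty
    product gives the unit ideal. *)
Lemma wreg_meets_sub fs T Q : [disjoint Q & T] ->
  {in Q, forall q, wreg (mem_ideal (var_ideal (q |: T))) fs} ->
  wreg (mem_ideal (sqfree_ideal k (fun U => meets T U || (Q \subset U)))) fs.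
Proof.
move: {2}#|Q| (leqnn #|Q|) => N; elim: N Q => [|N IH] Q cardQ QT regQ.
  move: cardQ; rewrite leqn0 cards_eq0 => /eqP ->.
  apply: wreg_full => h; apply/midealP=> m; rewrite sub0set orbT //.
case: (set_0Vmem Q) => [Q0|[q qQ]].
  by apply: IH => //; rewrite Q0 cards0.
have upD : nonfaces (fun U => meets T U || (Q \subset U)).
  move=> U V /orP[/(meets_nonfaces V)-> //|QU].
  by rewrite (subset_trans QU) ?subsetUl ?orbT.
have qT : q \notin T by rewrite (disjointFr QT).
apply: (@sqfree_ideal_wreg _ _ _ q) => //.
  apply: (@wreg_ext _ _
    (mem_ideal (sqfree_ideal k (fun U => meets T U || (Q :\ q \subset U))))).
    move=> h; rewrite /mem_ideal; set a := (X in is_true X <-> _).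
    set b := (X in _ <-> is_true X); suff -> : a = b by [].
    apply: sqfree_ideal_ext => U; rewrite subDset; congr (_ || _).
    apply/meetsP/meetsP=> -[i iT iU]; exists i => //.
      by rewrite inE iU orbT.
    by move: iU; rewrite !inE; case: eqP iT qT => // -> ->.
  apply: IH.
  - by rewrite (cardsD1 q) qQ in cardQ; rewrite -ltnS.
  - by apply: disjointWl QT; apply: subD1set.
  - by move=> p /setD1P[_ /regQ].
apply: wreg_ext (regQ q qQ) => h; rewrite /mem_ideal.
set a := (X in is_true X <-> _).
set b := (X in _ <-> is_true X); suff -> : a = b by [].
apply: sqfree_ideal_ext => U; apply/meetsP/or3P => [[i]|].
  case/setU1P=> [-> ->|iT iU]; first by constructor 1.
  by constructor 2; apply/meetsP; exists i.
case=> [qU|/meetsP[i iT iU]|/subsetP/(_ q qQ) qU].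
- by exists q; rewrite // setU11.
- by exists i; rewrite // !inE iT orbT.
- by exists q; rewrite // setU11.
Qed.

Fixpoint esyms m : seq S := if m is m'.+1 then mesym n k m'.+1 :: esyms m' else [::].

(** Any set of [m] variables other than the complement of [T] meets [T], so only one term of [mesym]
    survives. *)
Lemma mesym_var_ideal T m : #|~: T| = m ->
  mesym n k m - 'X_[mesym1 (~: T)] \in var_ideal T.
Proof.
move=> cardT; rewrite mesymE (bigD1 (~: T)) /= ?cardT // [X in X - _]addrC addrK.
apply: (is_ideal_sum (J := mem_ideal (var_ideal T))).
  exact/sqfree_idealP/meets_nonfaces.
move=> U /andP[/eqP cardU UT]; rewrite /mem_ideal var_idealX msupport_mesym1.
apply: contraNT UT => /negPn /eqP TU0; rewrite eqEcard cardT cardU leqnn andbT.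
by rewrite subsetC -disjoints_subset -setI_eq0 TU0.
Qed.

(* Modulo the variables in T the top elementary symmetric polynomial is the   *)
(* product of the remaining variables, so dividing by it reduces to ideals    *)
(* generated by one more variable.                                            *)
Lemma wreg_esyms T m : #|~: T| = m -> wreg (mem_ideal (var_ideal T)) (esyms m).
Proof.
elim: m T => // m IH T cardT /=; have [[/= var0 var1 _] varM] := var_ideal_prime T.
have varI : is_ideal (mem_ideal (var_ideal T)).
  exact/sqfree_idealP/meets_nonfaces.
have eT := mesym_var_ideal cardT; split=> [h eh|].
  have /varM : 'X_[mesym1 (~: T)] * h \in var_ideal T.
    have -> : 'X_[mesym1 (~: T)] * h = mesym n k m.+1 * h -
      h * (mesym n k m.+1 - 'X_[mesym1 (~: T)]) by ring.
    by apply: (is_idealB varI) => //; apply: (is_idealM _ varI).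
  rewrite var_idealX msupport_mesym1 => /orP[/meetsP[i iT]|//].
  by rewrite inE iT.
apply: (@wreg_ext _ _ (mem_ideal (sqfree_ideal k
    (fun U => meets T U || (~: T \subset U))))).
  move=> h; set b := adjoin _ _ _.
  have -> : mem_ideal (sqfree_ideal k
     (fun U => meets T U || (~: T \subset U))) h =
     (h \in mideal (fun m => meets T (msupport m) || (mesym1 (~: T) <= m)%MM)).
    by congr is_true; apply: mideal_ext => m'; rewrite mesym1_le.
  split=> [/mideal_adjoin|[a Ja]].
    move/(_ (nonfaces_upclosed (@meets_nonfaces T))) => -[a Ja]; exists a.
    have -> : h - a * mesym n k m.+1 = (h - a * 'X_[mesym1 (~: T)])
       - a * (mesym n k m.+1 - 'X_[mesym1 (~: T)]) by ring.
    by apply: (is_idealB varI) => //; apply: (is_idealM _ varI).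
  apply/mideal_adjoin; first exact: (nonfaces_upclosed (@meets_nonfaces T)).
  exists a.
  have -> : h - a * 'X_[mesym1 (~: T)] = (h - a * mesym n k m.+1)
       + a * (mesym n k m.+1 - 'X_[mesym1 (~: T)]) by ring.
  by apply: (is_idealD varI) => //; apply: (is_idealM _ varI).
apply: wreg_meets_sub; first by rewrite disjoints_subset subxx.
move=> q qT; apply: IH; rewrite inE in qT.
move: cardT; rewrite [#|~: T|](cardsD1 q) inE qT add1n => -[<-].
by apply: eq_card => i; rewrite !inE negb_or.
Qed.

End VariablePrimes.

Arguments var_ideal k {n} T.

(** * Algebraic dependence *)

Lemma exists_left_kernel (k : fieldType) (R C : finType) (a : R -> C -> k) :
  (#|C| < #|R|)%N ->
  exists2 c : R -> k, exists x, c x != 0 & forall y, \sum_x c x * a x y = 0.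
Proof.
move=> ltCR; pose M := \matrix_(i < #|R|, j < #|C|) a (enum_val i) (enum_val j).
have : kermx M != 0.
  rewrite -mxrank_eq0 mxrank_ker subn_eq0 -ltnNge.
  exact: leq_ltn_trans (rank_leq_col _) ltCR.
case/rowV0Pn=> v /sub_kermxP vM /rV0Pn[i vi].
exists (fun x => v 0 (enum_rank x)) => [|y].
  by exists (enum_val i); rewrite enum_valK.
have /matrixP/(_ 0 (enum_rank y)) := vM; rewrite !mxE => {2}<-.
rewrite (reindex (@enum_val R predT)) /=; last exact: onW_bij (enum_val_bij _).
by apply: eq_bigr => j _; rewrite mxE enum_valK enum_rankK.
Qed.

Section AlgebraicDependence.
Variables (k : fieldType) (n : nat).
Local Notation S := {mpoly k[n]}.
Implicit Types (m : 'X_{1..n}) (f h : S).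

Definition mdeg_le b f := all (fun m => mdeg m <= b)%N (msupp f).

Lemma mdeg_leM b c f h : mdeg_le b f -> mdeg_le c h -> mdeg_le (b + c) (f * h).
Proof.
move=> /allP fb /allP gc; apply/allP=> m /msuppM_le/allpairsP[[m1 m2] /=].
by case=> /fb b1 /gc c2 ->; rewrite mdegD leq_add.
Qed.

Lemma mdeg_le_expn b f e : mdeg_le b f -> mdeg_le (e * b) (f ^+ e).
Proof.
move=> fb; elim: e => [|e IH]; last by rewrite exprS mulSn mdeg_leM.
by rewrite /mdeg_le expr0 msupp1 /= mdeg0.
Qed.

Lemma mdeg_le_prod (I : finType) (b : I -> nat) (f : I -> S) :
  (forall i, mdeg_le (b i) (f i)) -> mdeg_le (\sum_i b i)%N (\prod_i f i).
Proof.
move=> fb; apply: (big_ind2 (fun x y => mdeg_le x y)) => //.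
  by rewrite /mdeg_le msupp1 /= mdeg0.
by move=> *; apply: mdeg_leM.
Qed.

(** The domain is a finite type of known cardinality that reaches every monomial of degree at most
    [M] in at most [d] variables; a bound on their number is all that is wanted. *)
Definition sparse_mnm (d M : nat) (g : {ffun 'I_d -> option ('I_n * 'I_M.+1)}) :
    'X_{1..n} :=
  (\sum_j (if g j is Some ib then U_(ib.1) *+ ib.2 else 0%MM))%MM.

Lemma sparse_mnm_onto d M m : (#|msupport m| <= d)%N -> (mdeg m <= M)%N ->
  exists g, m = @sparse_mnm d M g.
Proof.
move=> card_m deg_m; pose s := [seq Some i | i <- enum (msupport m)].
exists [ffun j : 'I_d => omap (fun i => (i, inord (m i))) (nth None s j)].
have le_s : (size s <= d)%N by rewrite size_map -cardE.
pose F o := if o is Some i then (U_(i) *+ m i)%MM else 0%MM : 'X_{1..n}.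
have mE : m = (\sum_(o <- s) F o)%MM.
  rewrite big_map big_enum [LHS]multinomUE_id (bigID [in msupport m]) /=.
  rewrite [X in (_ + X)%MM]big1 ?addm0 // => i.
  by rewrite inE lt0n negbK => /eqP ->; rewrite mulm0n.
rewrite [LHS]mE (big_nth None) big_mkord (big_ord_widen _ (F \o nth None s) le_s).
rewrite big_mkcond; apply: eq_bigr => j _; rewrite ffunE /=.
case: ltnP => [_|le_sj]; last by rewrite nth_default.
case: (nth None s j) => //= i; rewrite inordK // ltnS (leq_trans _ deg_m) //.
by rewrite mdegE (bigD1 i) //= leq_addr.
Qed.

(* Monomials of degree < N in d + 1 polynomials outnumber the monomials of    *)
(* comparable degree with support in at most d variables once N is large.     *)
Lemma alg_dependent (D : pred {set 'I_n}) d (f : 'I_d.+1 -> S) :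
  (forall U, ~~ D U -> (#|U| <= d)%N) ->
  exists N (c : {ffun 'I_d.+1 -> 'I_N} -> k), (exists e, c e != 0) /\
    \sum_e c e *: \prod_i f i ^+ e i \in sqfree_ideal k D.
Proof.
move=> leD; pose deg := (\sum_i msize (f i))%N.
(* There are N^(d+1) unknowns and at most ((n+1)(deg+1)N)^d equations, which is less because
   ((n+1)(deg+1))^d < N. *)
pose N := ((n.+1 * deg.+1) ^ d).+1; exists N.
pose a (e : {ffun 'I_d.+1 -> 'I_N}) g :=
  (\prod_i f i ^+ e i)@_(@sparse_mnm d (N * deg) g).
have deg_e (e : {ffun 'I_d.+1 -> 'I_N}) :
    mdeg_le (N * deg) (\prod_i f i ^+ e i).
  have : mdeg_le (\sum_i e i * msize (f i))%N (\prod_i f i ^+ e i).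
    apply: mdeg_le_prod => i; apply: mdeg_le_expn.
    by apply/allP=> m /msize_mdeg_lt/ltnW.
  move=> /allP le_e; apply/allP=> m /le_e /leq_trans; apply.
  by rewrite /deg big_distrr leq_sum //= => i _; rewrite leq_mul2r ltnW ?orbT.
have [|c c_neq0 ca] := exists_left_kernel a.
  rewrite !card_ffun !card_ord card_option card_prod !card_ord expnS.
  apply: (@leq_ltn_trans ((n.+1 * deg.+1) ^ d * N ^ d)%N); last first.
    by rewrite ltn_mul2r expn_gt0 ltnSn.
  have le_exp x y e : (x <= y -> x ^ e <= y ^ e)%N by case: e => // e; rewrite leq_exp2r.
  by rewrite -expnMn; apply: le_exp; rewrite /N; nia.
exists c; split=> //; apply/midealP=> m Dm; rewrite raddf_sum /=.
under eq_bigr do rewrite mcoeffZ.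
case: (leqP (mdeg m) (N * deg)) => [deg_m|deg_m].
  by have [g ->] := sparse_mnm_onto (leD _ Dm) deg_m; apply: ca.
apply: big1 => e _; rewrite memN_msupp_eq0 ?mulr0 //.
by apply: contraL deg_m => /(allP (deg_e e)); rewrite -leqNgt.
Qed.

(* An algebraic relation among f_0, ..., f_d modulo I with lexicographically  *)
(* least exponent e reads f_0^e_0 (f_1^e_1 (... (c + a_d f_d) ...) + a_0 f_0) *)
(* in I, and the leading powers can be cancelled one at a time.               *)
Lemma no_long_chain (D : pred {set 'I_n}) d (f : 'I_d.+1 -> S)
    (J : nat -> S -> Prop) :
  (forall U, ~~ D U -> (#|U| <= d)%N) ->
  (forall i, (i <= d.+1)%N -> is_ideal (J i)) ->
  (forall h, h \in sqfree_ideal k D -> J 0 h) ->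
  (forall i, (i <= d)%N -> forall h, J i h -> J i.+1 h) ->
  (forall i : 'I_d.+1, J i.+1 (f i)) ->
  (forall (i : 'I_d.+1) h, J i (f i * h) -> J i h) ->
  J d.+1 1.
Proof.
move=> leD idJ DJ subJ fJ regJ.
have [N [c [[e0 ce0] rel]]] := alg_dependent f leD.
(* Invariant: the exponents in [E] agree in their first [i] coordinates, and the relation with the
   powers of these [f j] cancelled holds modulo [J i]. *)
have step i : (i <= d.+1)%N -> exists E : {set {ffun 'I_d.+1 -> 'I_N}},
    [/\ E != set0, {in E, forall e, c e != 0},
     {in E &, forall e e' : {ffun 'I_d.+1 -> 'I_N}, forall j : 'I_d.+1,
        (j < i)%N -> e j = e' j} &
     J i (\sum_(e in E) c e *: \prod_(j : 'I_d.+1 | (i <= j)%N) f j ^+ e j)].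
  elim: i => [|i IH] le_id.
    exists [set e | c e != 0]; split=> //.
    - by apply/set0Pn; exists e0; rewrite inE.
    - by move=> e; rewrite inE.
    apply: DJ; rewrite (_ : \sum_(e in _) _ = \sum_e c e *: \prod_i f i ^+ e i) //.
    rewrite [RHS](bigID (fun e => c e != 0)) /= [X in _ = _ + X]big1 ?addr0.
      by apply: eq_bigl => e; rewrite inE.
    by move=> e /negPn/eqP ->; rewrite scale0r.
  have [E [/set0Pn[e1 Ee1] cE agreeE JE]] := IH (ltnW le_id).
  pose oi := Ordinal le_id.
  pose em := [arg min_(e < e1 in E) (e oi : nat)].
  have [Eem min_em] : em \in E /\ forall e, e \in E -> (em oi <= e oi)%N.
    by rewrite /em; case: arg_minnP.
  exists [set e in E | e oi == em oi]; split.
  - by apply/set0Pn; exists em; rewrite inE Eem eqxx.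
  - by move=> e; rewrite inE => /andP[/cE].
  - move=> e e'; rewrite !inE => /andP[Ee /eqP ei] /andP[Ee' /eqP e'i] j.
    rewrite ltnS leq_eqVlt => /orP[/eqP ji|]; last exact: agreeE.
    by have -> : j = oi by [apply: val_inj]; rewrite ei.
  have idJi := idJ _ (ltnW le_id); have idJi1 := idJ _ le_id.
  have factor e : e \in E ->
     c e *: \prod_(j : 'I_d.+1 | (i <= j)%N) f j ^+ e j = f oi ^+ em oi *
     (f oi ^+ (e oi - em oi) * (c e *: \prod_(j : 'I_d.+1 | (i < j)%N) f j ^+ e j)).
    move=> Ee; rewrite mulrA -exprD subnKC ?min_em // -scalerAr.
    congr (_ *: _); rewrite (bigD1 oi) //=; congr (_ * _); apply: eq_bigl => j.
    by rewrite ltn_neqAle andbC eq_sym.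
  have cancel_pow p h : J i (f oi ^+ p * h) -> J i h.
    elim: p h => [|p IHp] h; first by rewrite expr0 mul1r.
    by rewrite exprS -mulrA => /(regJ oi)/IHp.
  move: JE; rewrite (eq_bigr _ factor) -mulr_sumr => /cancel_pow/subJ.
  move=> /(_ le_id); rewrite (bigID (fun e : {ffun 'I_d.+1 -> 'I_N} => e oi == em oi)) /= => JE.
  set x := \sum_(e in _) _; set y := (X in _ + X) in JE.
  have -> : x = (x + y) - y by rewrite addrK.
  apply: is_idealB => //.
    suff -> : x = \sum_(e : {ffun 'I_d.+1 -> 'I_N} | (e \in E) && (e oi == em oi)) f oi ^+ (e oi - em oi) *
        (c e *: \prod_(j : 'I_d.+1 | (i < j)%N) f j ^+ e j) by [].
    apply: eq_big => [e|e]; first by rewrite inE.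
    by rewrite inE => /andP[_ /eqP ->]; rewrite subnn expr0 mul1r.
  (* A term whose exponent at [i] exceeds the minimum keeps a factor [f oi], which lies in
     [J i.+1]. *)
  apply: is_ideal_sum => // e /andP[Ee e_neq].
  rewrite mulrC; apply: is_idealM => //.
  have -> : (e oi - em oi)%N = (e oi - em oi).-1.+1.
    by rewrite prednK // subn_gt0 ltn_neqAle eq_sym e_neq min_em.
  by rewrite exprSr; apply: is_idealM => //; apply: (fJ oi).
(* All coordinates now agree, so one term is left, and it is a nonzero constant. *)
have [E [/set0Pn[e Ee] cE agreeE JE]] := step d.+1 (leqnn _).
have E1 : E = [set e].
  apply/setP=> e'; rewrite inE; apply/idP/eqP => [Ee'|->//].
  by apply/ffunP=> j; apply: agreeE.
move: JE; rewrite E1 big_set1 big_pred0 => [|j]; last by rewrite leqNgt ltn_ord.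
have idJd := idJ _ (leqnn d.+1).
move=> /(is_idealM (c e)^-1%:MP idJd).
by rewrite mul_mpolyC scalerA mulVf ?scale1r // cE.
Qed.

End AlgebraicDependence.

(** * Dimension, codimension and depth *)

Section GeneratedIdeals.
Variables (k : fieldType) (n : nat).
Local Notation S := {mpoly k[n]}.
Implicit Types (gs fs : seq S) (f h : S) (P : {pred S}).

Lemma in_ideal_nil f : in_ideal [::] f <-> f = 0.
Proof.
split=> [[c ->]|->]; first by rewrite big_ord0.
by exists (fun=> 0); rewrite big_ord0.
Qed.

Lemma in_ideal_rcons gs g h : in_ideal (rcons gs g) h <-> adjoin (in_ideal gs) g h.
Proof.
have sumE (c : nat -> S) : \sum_(i < size (rcons gs g)) c i * (rcons gs g)`_i =
    \sum_(i < size gs) c i * gs`_i + c (size gs) * g.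
  rewrite size_rcons big_ord_recr /= nth_rcons ltnn eqxx; congr (_ + _).
  by apply: eq_bigr => i _; rewrite nth_rcons ltn_ord.
split=> [[c ->]|[a [c hE]]].
  by exists (c (size gs)); exists c; rewrite sumE addrK.
pose c' i := if (i < size gs)%N then c i else a.
exists c'; rewrite sumE /c' ltnn -[h](subrK (a * g)) hE; congr (_ + _).
by apply: eq_bigr => i _; rewrite ltn_ord.
Qed.

Lemma in_ideal_ideal gs : is_ideal (in_ideal gs).
Proof.
split; first by exists (fun=> 0); rewrite big1 // => i _; rewrite mul0r.
move=> a u v [c ->] [d ->]; exists (fun i => a * c i + d i).
rewrite mulr_sumr -big_split; apply: eq_bigr => i _ /=; ring.
Qed.

Lemma in_ideal_catl gs fs h : in_ideal gs h -> in_ideal (gs ++ fs) h.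
Proof.
move=> gsh; elim/last_ind: fs => [|fs f IH]; first by rewrite cats0.
by rewrite -rcons_cat; apply/in_ideal_rcons/adjoin_sub.
Qed.

Lemma in_ideal_sub gs (J : S -> Prop) h : is_ideal J ->
  {in gs, forall g, J g} -> in_ideal gs h -> J h.
Proof.
move=> idJ Jgs [c ->]; apply: is_ideal_sum => // i _.
by apply: is_idealM => //; apply/Jgs/mem_nth.
Qed.

Lemma in_ideal_monomials (s : seq 'X_{1..n}) h :
  in_ideal [seq 'X_[m] | m <- s] h <->
  h \in @mideal k n (fun m => has (fun g => (g <= m)%MM) s).
Proof.
elim/last_ind: s h => [|s g IH] h.
  rewrite in_ideal_nil; split=> [->|/midealP h0]; first by rewrite inE msupp0.
  by apply/mpolyP=> m; rewrite mcoeff0; apply: h0.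
rewrite map_rcons in_ideal_rcons (adjoin_ext _ IH).
rewrite mideal_adjoin => [|m m' /hasP[g' g's g'm]]; last first.
  by apply/hasP; exists g' => //; apply: lepm_trans g'm (lem_addr _ _).
set a := (X in is_true X <-> _).
set b := (X in _ <-> is_true X); suff -> : a = b by [].
by apply: mideal_ext => m; rewrite has_rcons orbC.
Qed.

Lemma wreg_regular gs fs : wreg (in_ideal gs) fs ->
  forall i h, (i < size fs)%N -> in_ideal (gs ++ take i fs) (fs`_i * h) ->
  in_ideal (gs ++ take i fs) h.
Proof.
elim: fs gs => //= f fs IH gs [regf regfs] [|i] h /=.
  by rewrite cats0 => _; apply: regf.
rewrite -cat_rcons ltnS; apply: IH; apply: wreg_ext regfs => h'.
by rewrite in_ideal_rcons.
Qed.

Lemma in_ideal_coef0 gs h : {in gs, forall g, g@_0%MM = 0} ->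
  in_ideal gs h -> h@_0%MM = 0.
Proof.
move=> gs0 [c ->]; rewrite raddf_sum /= big1 // => i _.
by rewrite rmorphM /= (gs0 gs`_i) ?mulr0 ?mem_nth.
Qed.

Lemma prime_is_ideal P : prime_ideal P -> is_ideal (mem_ideal P).
Proof. by case=> -[P0 _ idP] _; split=> // a u v Pu Pv; apply: idP. Qed.

Lemma prime_ideal1 P : prime_ideal P -> 1 \notin P.
Proof. by case=> -[]. Qed.

(** In a longer chain pick [f i] in the prime [c i.+1] but not in [c i]. Primality makes [f i]
    regular modulo [c i], so [no_long_chain] puts 1 into a prime. *)
Lemma prime_chain_bound (D : pred {set 'I_n}) d gs e c :
  (forall U, ~~ D U -> (#|U| <= d)%N) ->
  (forall h, h \in sqfree_ideal k D -> in_ideal gs h) ->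
  prime_chain gs e c -> (e <= d)%N.
Proof.
move=> leD Dgs [primec gsc subc]; rewrite leqNgt; apply/negP=> lt_de.
have [i|f fc fNc] := @fin_all_exists2 'I_d.+1 (fun=> S)
    (fun i f => f \in c i.+1) (fun i f => f \notin c i).
  by have [] := subc i (leq_trans (ltn_ord i) lt_de).
have /negP := prime_ideal1 (primec _ lt_de); apply.
apply: (no_long_chain (f := f) (J := fun i => mem_ideal (c i)) leD).
- by move=> i le_id; apply/prime_is_ideal/primec/(leq_trans le_id).
- move=> h /Dgs; apply: in_ideal_sub; first exact/prime_is_ideal/primec.
  by move=> g; apply: gsc.
- move=> i le_id; have [] := subc i; first by lia.
  by move=> sub_c _ h; apply: sub_c.
- exact: fc.
move=> i h; have [_ prime_c] := primec i (ltnW (leq_trans (ltn_ord i) lt_de)).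
by move=> /prime_c; rewrite (negPf (fNc i)).
Qed.

Lemma prime_chain_le e (c : nat -> {pred S}) : prime_chain [::] e c -> (e <= n)%N.
Proof.
(* Without nonfaces the Stanley-Reisner ideal is zero and the largest face consists of all [n]
   variables. *)
move=> chain_c; apply: (prime_chain_bound (D := pred0) _ _ chain_c).
  by move=> U _; rewrite -[X in (_ <= X)%N]card_ord max_card.
move=> h /midealP h0; apply/in_ideal_nil/mpolyP=> m.
by rewrite mcoeff0; apply: h0.
Qed.

(** Here [J i] is generated by [gs] and the first [i] elements of the sequence; a longer sequence
    would generate the unit ideal with its first [d.+1] elements. *)
Lemma regular_seq_bound (D : pred {set 'I_n}) d gs fs :
  (forall U, ~~ D U -> (#|U| <= d)%N) ->
  (forall h, h \in sqfree_ideal k D -> in_ideal gs h) ->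
  regular_seq gs fs -> (size fs <= d)%N.
Proof.
move=> leD Dgs [reg notin1]; rewrite leqNgt; apply/negP=> lt_d; apply: notin1.
rewrite -(cat_take_drop d.+1 fs) catA; apply: in_ideal_catl.
have takeE i : (i < size fs)%N ->
    gs ++ take i.+1 fs = rcons (gs ++ take i fs) fs`_i.
  by move=> lt_i; rewrite (take_nth 0 lt_i) rcons_cat.
apply: (no_long_chain (f := fun i : 'I_d.+1 => fs`_i)
    (J := fun i => in_ideal (gs ++ take i fs)) leD).
- by move=> i _; apply: in_ideal_ideal.
- by move=> h /Dgs; rewrite take0 cats0.
- move=> i le_id h; rewrite takeE; last by lia.
  by move=> ?; apply/in_ideal_rcons/adjoin_sub.
- move=> i; rewrite takeE; last by have := ltn_ord i; lia.
  by apply/in_ideal_rcons/adjoin_mem/in_ideal_ideal.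
by move=> i h; apply: reg; have := ltn_ord i; lia.
Qed.

Implicit Types (T U : {set 'I_n}) (s : seq 'I_n).

Lemma var_idealU T i : ('X_i \in var_ideal k T) = (i \in T).
Proof.
rewrite var_idealX msupport1; apply/meetsP/idP => [[j jT /set1P <-] //|iT].
by exists i; rewrite ?set11.
Qed.

Lemma var_ideal_sub T P h : prime_ideal P -> {in T, forall i, 'X_i \in P} ->
  h \in var_ideal k T -> h \in P.
Proof.
move=> primeP TP /allP hT; rewrite [h]mpolyE big_seq.
have idP := prime_is_ideal primeP.
apply: (is_ideal_sum _ idP) => m /hT /= /meetsP[i /TP Xi].
rewrite inE lt0n -lep1mP => /submK <-; rewrite -mul_mpolyC mpolyXD mulrA.
exact: (is_idealM _ idP).
Qed.

Lemma var_ideal_chain s : uniq s ->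
  prime_chain [::] (size s) (fun i => var_ideal k [set x in take i s]).
Proof.
move=> uniq_s; split=> [i _||i lt_i]; [exact: var_ideal_prime|by []|].
case: s uniq_s lt_i => // x0 s'; set s := x0 :: s' => uniq_s lt_i.
have takeE : take i.+1 s = rcons (take i s) (nth x0 s i) by apply: take_nth.
split.
  move=> h; apply: var_ideal_sub; first exact: var_ideal_prime.
  by move=> j; rewrite var_idealU !in_set takeE mem_rcons in_cons => ->; rewrite orbT.
exists 'X_(nth x0 s i); rewrite var_idealU in_set ?takeE.
  by rewrite mem_rcons mem_head.
by have := take_uniq i.+1 uniq_s; rewrite takeE rcons_uniq => /andP[].
Qed.

(** A maximal chain of primes generated by variables that passes through [var_ideal T] at index
    [#|T|]. *)
Definition var_flag T i : {pred S} :=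
  var_ideal k [set x in take i (enum T ++ enum (~: T))].

Lemma var_flag_chain T : prime_chain [::] n (var_flag T).
Proof.
have size_n : size (enum T ++ enum (~: T)) = n.
  by rewrite size_cat -!cardE cardsC card_ord.
have := @var_ideal_chain (enum T ++ enum (~: T)); rewrite size_n; apply.
 rewrite cat_uniq !enum_uniq /= andbT.
by apply/hasPn=> x; rewrite !mem_enum inE.
Qed.

Lemma var_flag_card T : var_flag T #|T| =i var_ideal k T.
Proof.
move=> h; rewrite /var_flag take_size_cat -?cardE //.
by rewrite (_ : [set x in enum T] = T) //; apply/setP=> x; rewrite inE mem_enum.
Qed.

(** A chain ending at [var_ideal T], continued by the part of the flag above [T], is a chain of
    primes of the polynomial ring and so has length at most [n]. *)
Lemma prime_chain_ge gs e (c : nat -> {pred S}) T : prime_chain gs e c ->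
  (forall h, h \in c e -> h \in var_ideal k T) ->
  (forall h, h \in var_ideal k T -> h \in c e) ->
  (e + (n - #|T|) <= n)%N.
Proof.
case=> primec _ subc ceT Tce; have [primev _ subv] := var_flag_chain T.
have leT : (#|T| <= n)%N by rewrite -[X in (_ <= X)%N]card_ord max_card.
pose c' i := if (i <= e)%N then c i else var_flag T (#|T| + (i - e))%N.
apply: (@prime_chain_le _ c'); split=> // [i le_i|i lt_i].
  by rewrite /c'; case: leqP => le_ie; [apply: primec|apply: primev; lia].
rewrite /c'; have [lt_ie|le_ei] := ltnP i e; first by rewrite ltnW //; apply: subc.
have [sub_v [f f_in f_notin]] := subv (#|T| + (i - e))%N ltac:(lia).
rewrite subSn // addnS; case: leqP => le_ie.
  have ei : e = i by lia.
  subst e; rewrite subnn addn0 in sub_v f_in f_notin *; split.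
    by move=> h /ceT; rewrite -var_flag_card; apply: sub_v.
  by exists f => //; move: f_notin; rewrite var_flag_card; apply/contra/ceT.
by split=> //; exists f.
Qed.

Lemma height_var_ideal T : height (var_ideal k T) #|T|.
Proof.
split.
  exists (var_flag T); last exact: var_flag_card.
  have [primev _ subv] := var_flag_chain T.
  have leT : (#|T| <= n)%N by rewrite -[X in (_ <= X)%N]card_ord max_card.
  by split=> // i lei; [apply: primev|apply: subv]; apply: leq_trans lei leT.
move=> e [c chain_c cT]; have leT : (#|T| <= n)%N by rewrite -[X in (_ <= X)%N]card_ord max_card.
suff : (e + (n - #|T|) <= n)%N by lia.
by apply: (prime_chain_ge chain_c) => h; rewrite cT.
Qed.

Lemma codim_le gs d T : {in gs, forall g, g \in var_ideal k T} ->
  codim gs d -> (d <= #|T|)%N.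
Proof.
move=> gsT [_]; apply; exists (var_ideal k T).
by split=> //; [apply: var_ideal_prime|apply: height_var_ideal].
Qed.

Lemma prime_exp P f e : prime_ideal P -> f ^+ e \in P -> (0 < e)%N && (f \in P).
Proof.
move=> primeP; elim: e => [|e IH]; first by rewrite (negPf (prime_ideal1 primeP)).
by rewrite exprS => /(proj2 primeP)/orP[//|/IH/andP[]].
Qed.

Lemma prime_monomial P m : prime_ideal P -> 'X_[m] \in P ->
  exists2 i, (0 < m i)%N & 'X_i \in P.
Proof.
move=> primeP; rewrite mpolyXE_id.
elim: (index_enum _) => [|i s IH].
  by rewrite big_nil (negPf (prime_ideal1 primeP)).
rewrite big_cons => /(proj2 primeP)/orP[|//].
by case/(prime_exp primeP)/andP; exists i.
Qed.

(** A prime containing the monomials contains a variable of each of them. Its variables thus form a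
    transversal [U], and its height is at least [#|U|]. *)
Lemma codim_monomials (s : seq 'X_{1..n}) T :
  {in s, forall m, meets T (msupport m)} ->
  (forall U, {in s, forall m, meets U (msupport m)} -> (#|T| <= #|U|)%N) ->
  codim [seq 'X_[k, m] | m <- s] #|T|.
Proof.
move=> sT minT; split.
  exists (var_ideal k T); split; [exact: var_ideal_prime| |exact: height_var_ideal].
  by move=> g /mapP[m ms ->]; rewrite var_idealX; apply: sT.
move=> e [P [primeP sP [_ maxP]]]; pose U := [set i | 'X_i \in P].
have sU : {in s, forall m, meets U (msupport m)}.
  move=> m ms; have [|i mi Xi] := prime_monomial (m := m) primeP.
    by apply/sP/map_f.
  by apply/meetsP; exists i; rewrite inE.
apply: leq_trans (minT U sU) _; apply: maxP.
have UP : {in U, forall i, 'X_i \in P} by move=> i; rewrite inE.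
have [primev _ subv] := var_flag_chain U.
have leU : (#|U| <= n)%N by rewrite -[X in (_ <= X)%N]card_ord max_card.
(* The prime [P] takes the place of [var_ideal U], which it contains, at the top of the flag. *)
exists (fun i => if (i < #|U|)%N then var_flag U i else P); last first.
  by move=> h /=; rewrite ltnn.
split=> // [i le_i|i lt_i].
  by case: ifP => // lt_i; apply: primev; lia.
have [sub_i [f f_in f_notin]] := subv i (leq_trans lt_i leU).
rewrite lt_i; case: ltnP => le_i; first by split=> //; exists f.
have iU : i.+1 = #|U| by apply/eqP; rewrite eqn_leq lt_i le_i.
have vP h : h \in var_flag U i.+1 -> h \in P.
  by rewrite iU var_flag_card; apply: var_ideal_sub.
by split=> [h /sub_i/vP //|]; exists f => //; apply: vP.
Qed.

(** The size of the faces bounds chains from above; the part of the flag from [var_ideal T] upwards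
    attains the bound. *)
Lemma krull_dim_sqfree (D : pred {set 'I_n}) gs T :
  (forall U, ~~ D U -> (#|U| + #|T| <= n)%N) ->
  (forall h, h \in sqfree_ideal k D <-> in_ideal gs h) ->
  {in gs, forall g, g \in var_ideal k T} ->
  krull_dim gs (n - #|T|).
Proof.
move=> leD Dgs gsT.
have leT : (#|T| <= n)%N by rewrite -[X in (_ <= X)%N]card_ord max_card.
split=> [|e [c chain_c]]; last first.
  apply: (prime_chain_bound (D := D) _ _ chain_c) => [U /leD|h /Dgs //].
  by lia.
have [primev _ subv] := var_flag_chain T.
exists (fun i => var_flag T (#|T| + i)); split=> [i le_i|i le_i g gs_g|i lt_i].
- by apply: primev; lia.
- have /gsT := gs_g; rewrite -var_flag_card.
  elim: i le_i => [|i IH] le_i; first by rewrite addn0.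
  move=> gT; rewrite addnS; have [|sub_i _] := subv (#|T| + i)%N; first by lia.
  by apply/sub_i/IH => //; lia.
by rewrite addnS; apply: subv; lia.
Qed.

(** A weakly regular sequence without constant terms is regular, since 1 has a constant term;
    [regular_seq_bound] excludes longer ones. *)
Lemma depth_sqfree (D : pred {set 'I_n}) gs fs :
  (forall U, ~~ D U -> (#|U| <= size fs)%N) ->
  (forall h, h \in sqfree_ideal k D <-> in_ideal gs h) ->
  {in gs, forall g, g@_0%MM = 0} ->
  {in fs, forall f, f@_0%MM = 0} ->
  wreg (mem_ideal (sqfree_ideal k D)) fs ->
  depth gs (size fs).
Proof.
move=> leD Dgs gs0 fs0 regfs; split=> [|e [fs' [<- _ reg]]]; last first.
  by apply: (regular_seq_bound leD _ reg) => h /Dgs.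
exists fs; split=> //; split; last first.
  move/in_ideal_coef0; rewrite mcoeff1 eqxx => /(_ _)/eqP.
  rewrite oner_eq0; move=> contra; suff: false by []; apply: contra => g.
  by rewrite mem_cat => /orP[/gs0|/fs0].
by apply: wreg_regular; apply: wreg_ext regfs => h; apply: Dgs.
Qed.

End GeneratedIdeals.

(** * The cyclic order on the polygon *)

Lemma connect_invariant (T : finType) (e : rel T) (C : T -> Prop) :
  (forall x y, e x y -> C x -> C y) -> forall x y, connect e x y -> C x -> C y.
Proof.
move=> stepC x y /connectP[p]; elim: p x => [|z p IH] x /= => [_ -> //|].
by case/andP=> /stepC exz /IH pP lastp /exz; apply: pP.
Qed.

Section CyclicOrder.
Variable n : nat.
Implicit Types (i j v : 'I_n) (W : {set 'I_n}).

(** The number of steps from [i] forward to [j], written without modulo so that cyclic inequalities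
    reduce to case distinctions and [lia]. *)
Definition cdist i j : nat := if (i <= j)%N then (j - i)%N else (j + n - i)%N.

Lemma cdistE i j : ((j + n - i) %% n)%N = cdist i j.
Proof.
have := ltn_ord i; have := ltn_ord j; rewrite /cdist; case: (leqP i j) => le_ij ? ?.
  by rewrite (_ : j + n - i = j - i + n)%N ?modnDr ?modn_small //; lia.
by rewrite modn_small //; lia.
Qed.

Lemma cdist_lt i j : (cdist i j < n)%N.
Proof.
by have := ltn_ord i; have := ltn_ord j; rewrite /cdist; case: (leqP i j); lia.
Qed.

Lemma iter_ordS t i : iter t (@ordS n) i = ((i + t) %% n)%N :> nat.
Proof.
elim: t => [|t IH] /=; first by rewrite addn0 modn_small.
by rewrite IH -[in LHS]addn1 modnDml addn1 addnS.
Qed.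

Lemma iter_cdist i j : iter (cdist i j) (@ordS n) i = j.
Proof.
apply: val_inj; rewrite /= iter_ordS /cdist.
have := ltn_ord i; have := ltn_ord j; case: (leqP i j) => le_ij ? ?.
  by rewrite subnKC // modn_small.
by rewrite (_ : i + (j + n - i) = j + n)%N ?modnDr ?modn_small //; lia.
Qed.

Lemma cdist_iter i t : (t < n)%N -> cdist i (iter t (@ordS n) i) = t.
Proof.
move=> lt_tn; rewrite /cdist iter_ordS; have := ltn_ord i => lt_in.
case: (ltnP (i + t) n) => le_it.
  by rewrite modn_small // leq_addr addKn.
have -> : ((i + t) %% n = i + t - n)%N.
  by rewrite -[in LHS](subnK le_it) modnDr modn_small //; lia.
by case: leqP; lia.
Qed.

Lemma iter_ordS_n i : iter n (@ordS n) i = i.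
Proof. by apply: val_inj; rewrite /= iter_ordS modnDr modn_small. Qed.

Lemma cdist_ind (P : 'I_n -> Prop) : (forall i, P i -> P (ordS i)) ->
  forall i j, P i -> P j.
Proof.
by move=> PS i j Pi; rewrite -(iter_cdist i j); elim: (cdist i j) => //= t; apply: PS.
Qed.

Lemma edge_inS W i : i \in W -> ordS i \in W -> edge_in (polygon n) W i (ordS i).
Proof.
move=> iW SiW; apply/existsP; exists i; rewrite eqxx /=.
by apply/subsetP=> x /set2P[] ->.
Qed.

Lemma edge_in_sym W : symmetric (edge_in (polygon n) W).
Proof. by move=> i j; rewrite /edge_in setUC. Qed.

Lemma edge_inP W i j : edge_in (polygon n) W i j ->
  [/\ i \in W, j \in W & [\/ i = j, j = ordS i | i = ordS j]].
Proof.
case/existsP=> e /= /andP[/eqP ij /subsetP eW].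
have [iW jW] : i \in W /\ j \in W by split; apply: eW; rewrite ij !inE eqxx ?orbT.
split=> //; have := set21 i j; have := set22 i j; rewrite -ij.
by do 2!case/set2P=> ->; [constructor 1|constructor 3|constructor 2|constructor 1].
Qed.

(* A set of vertices is convex if it does not alternate with its complement   *)
(* around the polygon, i.e. if it is empty, a string or everything.           *)
Definition convex W := forall (u : 'I_n) (a b c : nat),
  (a < b < c)%N -> (c < n)%N -> u \in W ->
  iter a (@ordS n) u \notin W -> iter b (@ordS n) u \in W ->
  iter c (@ordS n) u \in W.

Lemma cdistS u i :
  cdist u (ordS i) = if (cdist u i).+1 == n then 0%N else (cdist u i).+1.
Proof.
have <- : iter (cdist u i).+1 (@ordS n) u = ordS i by rewrite iterS iter_cdist.
case: eqP => [->|neq_n]; last by rewrite cdist_iter //; have := cdist_lt u i; lia.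
by rewrite iter_ordS_n /cdist leqnn subnn.
Qed.

(** A path inside [W] cannot pass the missing vertices at distances [a] and [c], so from [u] it
    stays in the region [C] on its side of them and never reaches distance [b]. *)
Lemma connect_convex W :
  {in W &, forall u v, connect (edge_in (polygon n) W) u v} -> convex W.
Proof.
move=> connW u a b c lt_abc lt_cn uW aNW bW; apply: contraT => cNW.
pose C v := (cdist u v < a)%N || (c < cdist u v)%N.
have stepC x y : edge_in (polygon n) W x y -> C x -> C y.
  case/edge_inP=> xW yW xy.
  have neqW d : iter d (@ordS n) u \notin W -> (cdist u x != d) && (cdist u y != d).
    move=> dNW; apply/andP; split; apply: contraNneq dNW => <-;
    by rewrite iter_cdist.
  have := neqW _ aNW; have := neqW _ cNW; rewrite /C.
  have := cdist_lt u x; have := cdist_lt u y.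
  by case: xy => ->; rewrite ?cdistS; try case: ifP; lia.
have a_gt0 : (0 < a)%N by case: (posnP a) aNW => // ->; rewrite /= uW.
have Cu : C u by rewrite /C /cdist leqnn subnn; lia.
by have := connect_invariant stepC (connW u _ uW bW) Cu; rewrite /C cdist_iter; lia.
Qed.

Lemma connect_arc W u l : (forall t, (t <= l)%N -> iter t (@ordS n) u \in W) ->
  connect (edge_in (polygon n) W) u (iter l (@ordS n) u).
Proof.
elim: l => [|l IH] arcW /=; first exact: connect0.
apply: connect_trans (IH _) (connect1 _); first by move=> t /leqW; apply: arcW.
by apply: edge_inS; [apply: arcW|apply: (arcW l.+1)].
Qed.

(** If a vertex between [u] and [v] is missing, convexity puts the whole arc from [v] on to [u] into
    [W]. *)
Lemma convex_connect W : convex W ->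
  {in W &, forall u v, connect (edge_in (polygon n) W) u v}.
Proof.
move=> convW u v uW vW; have lt_d := cdist_lt u v; set d := cdist u v in lt_d.
have vE : v = iter d (@ordS n) u by rewrite iter_cdist.
have [arcW|] := boolP [forall t : 'I_n, (t <= d)%N ==> (iter t (@ordS n) u \in W)].
  rewrite vE; apply: connect_arc => t le_td.
  by have /forallP/(_ (Ordinal (leq_ltn_trans le_td lt_d)))/implyP := arcW; apply.
rewrite negb_forall => /existsP[i]; rewrite negb_imply => /andP[le_id iNW].
have uE : iter (n - d) (@ordS n) v = u.
  by rewrite vE -iterD subnK ?iter_ordS_n // ltnW.
have connv : connect (edge_in (polygon n) W) v u.
  rewrite -uE; apply: connect_arc => t le_t.
  have -> : iter t (@ordS n) v = iter (t + d) (@ordS n) u by rewrite vE -iterD.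
  have [t0|t_gt0] := posnP t; first by rewrite t0 -vE.
  have [tn|lt_tn] := eqVneq (t + d)%N n; first by rewrite tn iter_ordS_n.
  have i_gt0 : (0 < i)%N by case: (posnP i) iNW uW => // -> /= /negPf ->.
  have lt_id : (i < d)%N.
    rewrite ltn_neqAle le_id andbT; apply: contraNneq iNW => ->.
    by rewrite -vE.
  have := convW u i d (t + d)%N; rewrite -vE; apply=> //; lia.
by rewrite (sym_connect_sym (edge_in_sym W)).
Qed.

End CyclicOrder.

(** * Labels of faces and the square of the differential *)

Section FaceLabels.
Variables (k : fieldType) (n : nat) (X : cell_complex n) (A : labelling n).
Hypothesis incX : incidence_function X.
Local Notation S := {mpoly k[lvars A]}.

Lemma face_labE d (F : cell X d) p :
  face_lab A F p = (\max_(v in verts F) lab A v p)%N.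
Proof.
apply: (big_morph (fun m : 'X_{1..lvars A} => m p)) => [m m'|].
  exact: mnmE.
exact: mnm0E.
Qed.

Lemma face_lab_le d (F : cell X d) m :
  (face_lab A F <= m)%MM = [forall v in verts F, lab A v <= m]%MM.
Proof.
apply/mnm_lepP/forall_inP => [lem v vF|lem p].
  by apply/mnm_lepP=> p; have := lem p; rewrite face_labE => /bigmax_leqP; apply.
by rewrite face_labE; apply/bigmax_leqP=> v /lem/mnm_lepP.
Qed.

Lemma face_lab_subset d e (G : cell X d) (F : cell X e) :
  verts G \subset verts F -> (face_lab A G <= face_lab A F)%MM.
Proof.
move=> /subsetP GF; rewrite face_lab_le; apply/forall_inP=> v /GF vF.
by have := lepm_refl (face_lab A F); rewrite face_lab_le => /forall_inP; apply.
Qed.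

(** The monomial factors multiply to the quotient of the outer labels whatever the middle face is,
    which leaves the incidence relation. *)
Lemma bd_bd d (w : {ffun cell X d.+2 -> S}) : bd (bd w) = 0.
Proof.
case: incX => signX _ sum0; apply/ffunP=> H; rewrite !ffunE.
under eq_bigr do rewrite ffunE mulr_sumr.
rewrite exchange_big big1 //= => F _.
pose x := 'X_[face_lab A F - face_lab A H] * w F.
rewrite (eq_bigr (fun G => (sign H G * sign G F)%:~R * x)); last first.
  move=> G _; rewrite /bd_coef intrM /x.
  have := signX _ H G; have := signX _ G F.
  case: ifP => GF; last by move=> ->; rewrite !(mulr0, mul0r).
  case: ifP => HG; last by move=> _ ->; rewrite !(mulr0, mul0r).
  move=> _ _; have leGF := face_lab_subset GF; have leHG := face_lab_subset HG.
  have -> : (face_lab A F - face_lab A H =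
      (face_lab A G - face_lab A H) + (face_lab A F - face_lab A G))%MM.
    apply/mnmP=> i; rewrite !mnmE.
    by move/mnm_lepP: leGF => /(_ i); move/mnm_lepP: leHG => /(_ i); lia.
  rewrite mpolyXD; ring.
by rewrite -mulr_suml -rmorph_sum /= sum0 rmorph0 mul0r.
Qed.

End FaceLabels.

(** * Exactness and connectedness *)

Section LinearExtension.
Variables (k : fieldType) (n : nat) (V : lmodType k) (t : 'X_{1..n} -> V).
Local Notation S := {mpoly k[n]}.
Implicit Types f g : S.

Definition mlin f : V := \sum_(m <- msupp f) f@_m *: t m.

Lemma mlin_wide f (s : seq 'X_{1..n}) : uniq s -> {subset msupp f <= s} ->
  mlin f = \sum_(m <- s) f@_m *: t m.
Proof.
move=> uniq_s fs; rewrite (bigID [in msupp f]) /= [X in _ + X]big1 ?addr0.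
  rewrite -big_filter; apply: perm_big; apply: uniq_perm.
  - exact: msupp_uniq.
  - exact: filter_uniq.
  by move=> m; rewrite mem_filter; case: (boolP (_ \in _)) => // /fs ->.
by move=> m mf; rewrite memN_msupp_eq0 ?scale0r.
Qed.

Lemma mlinD f g : mlin (f + g) = mlin f + mlin g.
Proof.
pose s := undup (msupp f ++ msupp g).
have sP m : (m \in s) = (m \in msupp f) || (m \in msupp g).
  by rewrite mem_undup mem_cat.
rewrite !(@mlin_wide _ s) ?undup_uniq //.
- by rewrite -big_split; apply: eq_bigr => m _; rewrite mcoeffD scalerDl.
- by move=> m mg; rewrite sP mg orbT.
- by move=> m mf; rewrite sP mf.
by move=> m /msuppD_le; rewrite mem_cat sP.
Qed.

Lemma mlinX c m : mlin (c *: 'X_[m]) = c *: t m.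
Proof.
rewrite (@mlin_wide _ [:: m]) // ?big_seq1 ?mcoeffZ ?mcoeffX ?eqxx ?mulr1 //.
by move=> m' /msuppZ_le; rewrite msuppX.
Qed.

Lemma mlin0 : mlin 0 = 0.
Proof. by rewrite /mlin msupp0 big_nil. Qed.

Lemma mlin_sum (I : Type) (r : seq I) (F : I -> S) :
  mlin (\sum_(i <- r) F i) = \sum_(i <- r) mlin (F i).
Proof. by apply: big_morph; [apply: mlinD|apply: mlin0]. Qed.

End LinearExtension.

Lemma sum_unit (V : nmodType) (F : unit -> V) : \sum_x F x = F tt.
Proof. by rewrite (bigD1 tt) //= big1 ?addr0 // => -[]. Qed.

Section Resolution.
Variables (k : fieldType) (n : nat) (A : labelling n).
Local Notation S := {mpoly k[lvars A]}.
Local Notation X := (polygon n).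
Local Notation bd := (@bd k n X A).

(** The vertices of the subcomplex whose reduced homology is the homology of the cellular complex in
    degree [u]. *)
Definition dividing (u : 'X_{1..lvars A}) : {set 'I_n} := [set v | (lab A v <= u)%MM].

Lemma face_lab_vertex (v : 'I_n) : face_lab A (v : cell X 1) = lab A v.
Proof. by apply/mnmP=> p; rewrite face_labE /= big_set1. Qed.

Lemma face_lab_empty (e : unit) : face_lab A (e : cell X 0) = 0%MM.
Proof. by apply/mnmP=> p; rewrite face_labE /= big_set0 mnm0E. Qed.

Lemma face_lab_edge (i : 'I_n) u : (face_lab A (i : cell X 2) <= u)%MM =
  (i \in dividing u) && (ordS i \in dividing u).
Proof.
rewrite face_lab_le /= !inE; apply/forall_inP/andP => [le_u|[le_i le_Si] v].
  by rewrite !le_u ?set21 ?set22.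
by case/set2P=> ->.
Qed.

Lemma face_lab_top (e : unit) u :
  (face_lab A (e : cell X 3) <= u)%MM = (dividing u == setT).
Proof.
rewrite face_lab_le; apply/forall_inP/eqP => [le_u|divT v _].
  by apply/setP=> v; rewrite inE (le_u v (in_setT v)) inE.
by have : v \in dividing u; [rewrite divT|rewrite inE].
Qed.

Lemma mcoeffXM (a b : 'X_{1..lvars A}) (p : S) :
  ('X_[a] * p)@_b = if (a <= b)%MM then p@_(b - a) else 0.
Proof.
case: ifP => le_ab; first by rewrite -{1}(submK le_ab) addmC mulrC mcoeffMX.
apply: memN_msupp_eq0; rewrite mulrC (perm_mem (msuppMX _ _)).
by apply/negP=> /mapP[m _ bE]; rewrite bE lem_addr in le_ab.
Qed.

Lemma bd0E (z : {ffun 'I_n -> S}) (e : unit) :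
  bd (d := 0) z e = \sum_v 'X_[lab A v] * z v.
Proof.
rewrite ffunE; apply: eq_bigr => v _; rewrite /bd_coef face_lab_vertex.
by rewrite face_lab_empty subm0 mul1r.
Qed.

(* Coefficients in degree u of an exactness relation split the class of       *)
(* v - w as the boundary of a chain supported on the edges inside dividing u. *)
Lemma resolution_connected : (2 < n)%N -> cellular_resolution k X A ->
  forall u, {in dividing u &,
    forall v w, connect (edge_in X (dividing u)) v w}.
Proof.
move=> n_gt2 [_ exact_bd] u v w vu wu.
have [signX _ _] := polygon_incidence n_gt2.
have [<-|neq_vw] := eqVneq v w; first exact: connect0.
(* The homogeneous cycle of degree [u] that represents the difference of [v] and [w]. *)
pose z : {ffun 'I_n -> S} := [ffun x => (x == v)%:R * 'X_[u - lab A v] -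
  (x == w)%:R * 'X_[u - lab A w]].
have sumE (x0 : 'I_n) (F : 'I_n -> S) : \sum_x (x == x0)%:R * F x = F x0.
  rewrite (bigD1 x0) //= eqxx mul1r big1 ?addr0 // => x /negPf ->.
  by rewrite mul0r.
have z0 : bd (d := 0) z = 0.
  apply/ffunP=> e; rewrite bd0E ffunE.
  under eq_bigr do rewrite ffunE mulrBr (mulrCA _ (_ == v)%:R) (mulrCA _ (_ == w)%:R).
  rewrite sumrB !sumE; rewrite !inE in vu wu.
  by rewrite -!mpolyXD ![(lab A _ + _)%MM]addmC !submK // subrr.
have /exact_bd[y yE] := z0.
(* The part of [y F] in degree [u]; an edge whose label does not divide [u] has none. *)
pose c (F : 'I_n) := if (face_lab A (F : cell X 2) <= u)%MM
  then (y F)@_(u - face_lab A (F : cell X 2)) else 0.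
pose s (x F : 'I_n) : int := sign (x : cell X 1) (F : cell X 2).
have coefE x : x \in dividing u ->
    (x == v)%:R - (x == w)%:R = \sum_F (s x F)%:~R * c F.
  move=> xu; have : (z x)@_(u - lab A x) = (bd (d := 1) y x)@_(u - lab A x).
    by rewrite yE.
  rewrite !ffunE raddf_sum mcoeffB /=.
  have delta (b : 'I_n) : ((x == b)%:R * 'X_[u - lab A b] : S)@_(u - lab A x) =
      (x == b)%:R.
    case: eqP => [->|_]; last by rewrite mul0r mcoeff0.
    by rewrite mul1r mcoeffX eqxx.
  rewrite !delta => ->; apply: eq_bigr => F _.
  rewrite /bd_coef -/(s x F) face_lab_vertex -mulrA !mulrzl raddfMz.
  have := signX 1 x F; rewrite -/(s x F).
  case: ifP => [xF _|_ ->]; last by rewrite !mulr0z.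
  congr (_ *~ _); rewrite /= mcoeffXM /c.
  have le_xF : (lab A x <= face_lab A (F : cell X 2))%MM.
    by rewrite -face_lab_vertex; apply: face_lab_subset.
  rewrite inE in xu; move/mnm_lepP: (le_xF) => lexF; move/mnm_lepP: (xu) => lexu.
  have -> : (face_lab A (F : cell X 2) - lab A x <= u - lab A x)%MM =
      (face_lab A (F : cell X 2) <= u)%MM.
    apply/mnm_lepP/mnm_lepP => le p; have := le p; have := lexF p; have := lexu p;
    rewrite !mnmBE; lia.
  case: ifP => // /mnm_lepP leFu; congr (_@_ _); apply/mnmP=> p.
  by rewrite !mnmBE; have := lexF p; have := lexu p; have := leFu p; lia.
pose C : pred 'I_n := connect (edge_in X (dividing u)) v.
have CS i : c i != 0 -> C i = C (ordS i).
  rewrite /c; case: ifP => [|_]; last by rewrite eqxx.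
  rewrite face_lab_edge => /andP[iu Siu] _; apply: same_connect_r.
    exact/sym_connect_sym/edge_in_sym.
  exact/connect1/edge_inS.
(* Every edge with nonzero coefficient has both ends inside the component of [v] or both outside, so
   the sum over the component vanishes; if [w] were outside, it would be 1. *)
have : \sum_(x | C x && (x \in dividing u)) ((x == v)%:R - (x == w)%:R) = 0 :> k.
  rewrite (eq_bigr _ (fun x xC => coefE x (proj2 (andP xC)))) exchange_big /=.
  apply: big1 => F _; rewrite -mulr_suml.
  have [->|/[dup] cF /CS CF] := eqVneq (c F) 0; first by rewrite mulr0.
  have : (face_lab A (F : cell X 2) <= u)%MM.
    by move: cF; rewrite /c; case: ifP => //; rewrite eqxx.
  rewrite face_lab_edge => /andP[Fu SFu].
  rewrite -rmorph_sum /= sumrB.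
  have deltaC y0 : y0 \in dividing u ->
      \sum_(x | C x && (x \in dividing u)) (x == y0)%:Z = (C y0)%:Z.
    move=> y0u; case: (boolP (C y0)) => Cy0.
      rewrite (bigD1 y0) ?Cy0 //= eqxx big1 ?addr0 // => x /andP[_ /negPf -> //].
    by apply: big1 => x /andP[Cx _]; case: eqP Cx => // ->; rewrite (negPf Cy0).
  by rewrite !deltaC // CF subrr rmorph0 mul0r.
have Cv : C v by apply: connect0.
rewrite (bigD1 v) ?Cv ?vu //= eqxx (negPf neq_vw) subr0.
case: (boolP (C w)) => // Cw; rewrite big1 ?addr0 => [/eqP|x /andP[/andP[Cx _]]].
  by rewrite oner_eq0.
move=> /negPf ->; case: eqP Cx => [->|_ _]; first by rewrite (negPf Cw).
by rewrite subr0.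
Qed.

Lemma mpolyX_neq0 (m : 'X_{1..lvars A}) : 'X_[m] != 0 :> S.
Proof. by rewrite -msupp_eq0 msuppX. Qed.

Lemma bd1E (z : {ffun 'I_n -> S}) (v : 'I_n) : bd (d := 1) z (ordS v) =
  'X_[face_lab A (v : cell X 2) - lab A (ordS v)] * z v -
  'X_[face_lab A (ordS v : cell X 2) - lab A (ordS v)] * z (ordS v).
Proof.
pose a (w : 'I_n) := 'X_[face_lab A (w : cell X 2) - lab A (ordS v)] * z w.
rewrite ffunE (eq_bigr (fun w => (w == v)%:R * a w - (w == ordS v)%:R * a w)).
  have sumE (x0 : 'I_n) (F : 'I_n -> S) : \sum_x (x == x0)%:R * F x = F x0.
    rewrite (bigD1 x0) //= eqxx mul1r big1 ?addr0 // => x /negPf ->.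
    by rewrite mul0r.
  by rewrite sumrB !sumE.
move=> w _; rewrite /bd_coef face_lab_vertex /= (inj_eq (@ordS_inj n)).
rewrite /a -mulrBl -mulrA; congr (_ * _).
by rewrite rmorphB /= -!pmulrn (eq_sym v) (eq_sym (ordS v)).
Qed.

Lemma divisible_by_monomial (m : 'X_{1..lvars A}) (p : S) :
  (forall m', m' \in msupp p -> (m <= m')%MM) -> exists q, p = 'X_[m] * q.
Proof.
move=> le_m; exists (\sum_(m' <- msupp p) p@_m' *: 'X_[m' - m]).
rewrite {1}[p]mpolyE mulr_sumr !big_seq; apply: eq_bigr => m' /le_m le_mm'.
by rewrite -scalerAr -mpolyXD addmC submK.
Qed.

(** The cycle condition at each vertex says that label times coefficient is one polynomial [g] for
    all edges. All vertex labels divide its terms, hence so does the label of the 2-cell. *)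
Lemma exact_edges (z : {ffun 'I_n -> S}) : (0 < n)%N -> bd (d := 1) z = 0 ->
  exists w : {ffun unit -> S}, z = bd (d := 2) w.
Proof.
move=> n_gt0 z0; pose i0 := Ordinal n_gt0.
pose g (i : 'I_n) := 'X_[face_lab A (i : cell X 2)] * z i.
have gS i : g (ordS i) = g i.
  have /ffunP/(_ (ordS i)) := z0; rewrite bd1E !ffunE => /eqP; rewrite subr_eq0.
  have [iu Siu] : (lab A (ordS i) <= face_lab A (i : cell X 2))%MM /\
     (lab A (ordS i) <= face_lab A (ordS i : cell X 2))%MM.
    have := face_lab_edge (ordS i) (face_lab A (ordS i : cell X 2)).
    have := face_lab_edge i (face_lab A (i : cell X 2)).
    by rewrite !lepm_refl => /esym/andP[_ le1] /esym/andP[le2 _]; rewrite !inE in le1 le2 *.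
  move=> /eqP/(congr1 ( *%R 'X_[lab A (ordS i)])).
  by rewrite !mulrA -!mpolyXD ![(lab A _ + _)%MM]addmC !submK.
have gE i : g i = g i0.
  by apply: (@cdist_ind _ (fun i => g i = g i0) _ i0 i) => // j; rewrite gS.
have [|q gq] := @divisible_by_monomial (face_lab A (tt : cell X 3)) (g i0).
  move=> m gm; rewrite face_lab_top; apply/eqP/setP=> v; rewrite !inE.
  move: gm; rewrite -(gE v) /g mulrC (perm_mem (msuppMX _ _)) => /mapP[m' _ ->].
  apply: lepm_trans (lem_addr _ _).
  by have := face_lab_edge v (face_lab A (v : cell X 2));
    rewrite lepm_refl !inE => /esym/andP[].
exists [ffun=> q]; apply/ffunP=> i; rewrite ffunE sum_unit /= ffunE.
rewrite /bd_coef mul1r.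
apply: (mulfI (mpolyX_neq0 (face_lab A (i : cell X 2)))).
rewrite -/(g i) gE gq mulrA -mpolyXD addmC submK //.
by apply: face_lab_subset; apply: subsetT.
Qed.

Lemma bdZ d (c : k) (w : {ffun cell X d.+1 -> S}) :
  bd [ffun x => c *: w x] = [ffun x => c *: bd w x].
Proof.
apply/ffunP=> x; rewrite !ffunE scaler_sumr; apply: eq_bigr => y _.
by rewrite ffunE scalerAr.
Qed.

Lemma bdD d (w w' : {ffun cell X d.+1 -> S}) : bd (w + w') = bd w + bd w'.
Proof.
apply/ffunP=> x; rewrite !ffunE -big_split; apply: eq_bigr => y _.
by rewrite ffunE mulrDr.
Qed.

Hypothesis connA : forall u, {in dividing u &,
  forall v w, connect (edge_in X (dividing u)) v w}.

Let boundary (z : {ffun 'I_n -> S}) :=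
  exists w : {ffun 'I_n -> S}, z = bd (d := 1) w.

Let ev (v : 'I_n) (p : S) : {ffun 'I_n -> S} := [ffun x => if x == v then p else 0].

Let boundaryD z z' : boundary z -> boundary z' -> boundary (z + z').
Proof. by case=> w -> [w' ->]; exists (w + w'); rewrite bdD. Qed.

Let boundaryZ c z : boundary z -> boundary [ffun x => c *: z x].
Proof. by case=> w ->; exists [ffun x => c *: w x]; rewrite (@bdZ 1). Qed.

Let boundaryN z : boundary z -> boundary (- z).
Proof.
move=> /(boundaryZ (- 1)) [w wE]; exists w; rewrite -wE.
by apply/ffunP=> x; rewrite !ffunE scaleN1r.
Qed.

Let boundary0 : boundary 0.
Proof.
exists 0; apply/ffunP=> x; rewrite !ffunE big1 // => y _.
by rewrite ffunE mulr0.
Qed.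

Let boundary_sum (I : Type) (s : seq I) (F : I -> {ffun 'I_n -> S}) :
  (forall i, boundary (F i)) -> boundary (\sum_(i <- s) F i).
Proof. by move=> bF; apply: big_ind. Qed.

Lemma boundary_edge (i : 'I_n) u : (2 < n)%N ->
  i \in dividing u -> ordS i \in dividing u ->
  ev (ordS i) 'X_[u - lab A (ordS i)] - ev i 'X_[u - lab A i] =
  bd (d := 1) (ev i 'X_[u - face_lab A (i : cell X 2)]).
Proof.
move=> n_gt2 iu Siu; apply/ffunP=> x; rewrite !ffunE.
rewrite (bigD1 i) //= big1 ?addr0 => [|j /negPf ji]; last first.
  by rewrite ffunE ji mulr0.
rewrite ffunE eqxx /bd_coef face_lab_vertex -mulrA -mpolyXD /=.
have le_iu : (face_lab A (i : cell X 2) <= u)%MM by rewrite face_lab_edge iu Siu.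
have := face_lab_edge i (face_lab A (i : cell X 2)).
rewrite lepm_refl !inE => /esym/andP[le_i le_Si].
have E y : (lab A y <= face_lab A (i : cell X 2))%MM ->
    (face_lab A (i : cell X 2) - lab A y + (u - face_lab A (i : cell X 2)) =
     u - lab A y)%MM.
  move=> /mnm_lepP le_y; apply/mnmP=> p; rewrite !mnmE.
  by move/mnm_lepP: le_iu => /(_ p); have := le_y p; lia.
rewrite rmorphB /= mulrBl; congr (_ - _).
  by case: eqP => [->|_]; rewrite ?mul0r // mul1r E.
by case: eqP => [->|_]; rewrite ?mul0r // mul1r E.
Qed.

Lemma boundary_diff u v w : (2 < n)%N -> v \in dividing u -> w \in dividing u ->
  boundary (ev v 'X_[u - lab A v] - ev w 'X_[u - lab A w]).
Proof.
move=> n_gt2 vu wu.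
pose C x := boundary (ev v 'X_[u - lab A v] - ev x 'X_[u - lab A x]).
apply: (@connect_invariant _ _ C _ v w (connA vu wu)); last first.
  by rewrite /C subrr; apply: boundary0.
have edgeB i : i \in dividing u -> ordS i \in dividing u ->
    boundary (ev (ordS i) 'X_[u - lab A (ordS i)] - ev i 'X_[u - lab A i]).
  by move=> iu Siu; rewrite boundary_edge //; eexists.
move=> x y /edge_inP[xu yu xy] Cx; case: xy => [<- //|yE|xE].
  rewrite /C -(subrKA (ev x 'X_[u - lab A x])); apply: boundaryD => //.
  by rewrite -opprB; apply: boundaryN; rewrite yE; apply: edgeB; rewrite -?yE.
rewrite /C -(subrKA (ev x 'X_[u - lab A x])); apply: boundaryD => //.
by rewrite xE; apply: edgeB; rewrite -?xE.
Qed.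

(** Modulo boundaries a monomial multiple of a vertex depends only on its degree, by
    [boundary_diff]. Hence [z] is congruent to the linear image of its boundary, which is zero. *)
Lemma exact_vertices (z : {ffun 'I_n -> S}) : (2 < n)%N -> bd (d := 0) z = 0 ->
  boundary z.
Proof.
move=> n_gt2 z0; pose v0 := Ordinal (ltnW (ltnW n_gt2)).
pose rep m := odflt v0 [pick v in dividing m].
pose t m := ev (rep m) 'X_[m - lab A (rep m)].
have boundary_t v (p : S) : boundary (ev v p - mlin t ('X_[lab A v] * p)).
  elim/mpolyind: p => [|c m p _ _ IH].
    rewrite mulr0 mlin0 subr0 (_ : ev v 0 = 0) //.
    by apply/ffunP=> x; rewrite !ffunE; case: ifP.
  rewrite mulrDr mlinD -scalerAr -mpolyXD mlinX.
  have -> : ev v (c *: 'X_[m] + p) = c *: ev v 'X_[m] + ev v p.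
    by apply/ffunP=> x; rewrite !ffunE; case: ifP; rewrite ?scaler0 ?addr0.
  rewrite opprD addrACA -scalerBr; apply: boundaryD => //.
  have -> : ev v 'X_[m] = ev v 'X_[lab A v + m - lab A v].
    by rewrite addmC addmK.
  have vu : v \in dividing (lab A v + m)%MM by rewrite inE lem_addr.
  have ru : rep (lab A v + m)%MM \in dividing (lab A v + m)%MM.
    by rewrite /rep; case: pickP => [x //|/(_ v)]; rewrite vu.
  have [w wE] := boundaryZ c (boundary_diff n_gt2 vu ru); exists w; rewrite -wE.
  by apply/ffunP=> x; rewrite !ffunE.
have -> : z = \sum_v (ev v (z v) - mlin t ('X_[lab A v] * z v)).
  rewrite sumrB -mlin_sum -(bd0E z tt) z0 ffunE mlin0 subr0.
  apply/ffunP=> x; rewrite sum_ffunE (bigD1 x) //= ffunE eqxx big1 ?addr0 //.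
  by move=> y /negPf yx; rewrite ffunE eq_sym yx.
by apply: boundary_sum => v; apply: boundary_t.
Qed.

Lemma in_lab_gens (f : S) : in_ideal (lab_gens k A) f <->
  exists z : {ffun 'I_n -> S}, f = \sum_v 'X_[lab A v] * z v.
Proof.
have sumE (c : nat -> S) : \sum_(i < size (lab_gens k A)) c i * (lab_gens k A)`_i =
    \sum_v 'X_[lab A v] * c (val v).
  rewrite -(big_mkord xpredT (fun i => c i * (lab_gens k A)`_i)).
  rewrite size_map size_enum_ord big_mkord; apply: eq_bigr => v _.
  by rewrite (nth_map v) ?size_enum_ord // nth_ord_enum mulrC.
split=> [[c ->]|[z ->]].
  by exists [ffun v => c (val v)]; rewrite sumE; apply: eq_bigr => v _; rewrite ffunE.
pose c i : S := oapp z 0 (insub i).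
by exists c; rewrite sumE; apply: eq_bigr => v _; rewrite /c valK.
Qed.

Lemma connected_resolution : (2 < n)%N -> cellular_resolution k X A.
Proof.
move=> n_gt2; split=> [f|d z].
  rewrite in_lab_gens; split=> -[z zE]; exists z.
    by apply/ffunP=> e; rewrite bd0E ffunE.
  by rewrite -(bd0E z tt) zE ffunE.
split=> [|[w ->]]; last exact: (bd_bd (polygon_incidence n_gt2)).
case: d z => [|[|[|d]]] z z0.
- exact: exact_vertices.
- by apply: exact_edges => //; apply: ltnW (ltnW n_gt2).
- exists 0; apply/ffunP=> -[]; rewrite ffunE big1 => [|[]].
  have /ffunP/(_ (Ordinal (ltnW (ltnW n_gt2)))) := z0.
  rewrite !ffunE sum_unit /bd_coef mul1r => /eqP.
  by rewrite mulf_eq0 (negPf (mpolyX_neq0 _)) => /eqP.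
by exists 0; apply/ffunP=> -[].
Qed.

End Resolution.

Arguments dividing {n} A u.

Local Close Scope ring_scope.

(** * Families of strings *)

Section Arcs.
Variable n : nat.
Implicit Types (i j u v x : 'I_n) (S T : {set 'I_n}).
Local Notation step t := (iter t (@ordS n)).

(** Strings given by first vertex and length, so that the empty set and the whole polygon occur
    too. *)
Definition carc i l : {set 'I_n} := [set v | cdist i v < l].

Lemma cdistxx i : cdist i i = 0.
Proof. by rewrite /cdist leqnn subnn. Qed.

(** Measuring every distance from one base point [u] turns statements about arcs into linear
    arithmetic. *)
Lemma cdist_shift u i j : cdist i j =
  if cdist u i <= cdist u j then cdist u j - cdist u i
  else cdist u j + n - cdist u i.
Proof.
have lti := ltn_ord i; have ltj := ltn_ord j; have ltu := ltn_ord u.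
rewrite /cdist; case: (leqP i j) => ij; case: (leqP u i) => ui;
  by case: (leqP u j) => uj; case: ifP; lia.
Qed.

Lemma mem_arc_step i l t : t < n -> (step t i \in carc i l) = (t < l).
Proof. by move=> lt_tn; rewrite inE cdist_iter. Qed.

Lemma card_arc i l : l <= n -> #|carc i l| = l.
Proof.
move=> le_ln; have -> : carc i l = [set step t i | t : 'I_l].
  apply/setP=> v; rewrite inE; apply/idP/imsetP => [lt_l|[t _ ->]].
    by exists (Ordinal lt_l); rewrite //= iter_cdist.
  by rewrite cdist_iter ?(leq_trans (ltn_ord t)).
rewrite card_in_imset ?card_ord // => t t' _ _ /(congr1 (cdist i)).
by rewrite !cdist_iter ?(leq_trans (ltn_ord _) le_ln) // => /val_inj.
Qed.

(** If [i] and [j] differed, the vertex just before [j] would lie in the arc from [i] but not in the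
    equal arc from [j]. *)
Lemma arc_sub_inj l i j : 0 < l < n -> carc i l \subset carc j l -> i = j.
Proof.
move=> lt_l sub_ij; have eq_ij : carc i l = carc j l.
  by apply/eqP; rewrite eqEcard sub_ij !card_arc //; lia.
have lt_d := cdist_lt i j.
rewrite -(iter_cdist i j); case dE: (cdist i j) => [//|d].
have : j \in carc i l by rewrite eq_ij inE cdistxx; lia.
have : step d i \notin carc j l.
  by rewrite inE (cdist_shift i j) cdist_iter ?dE; [case: ifP|]; lia.
by rewrite -eq_ij !inE dE cdist_iter; lia.
Qed.

Lemma stringE i j : string i j = carc i (cdist i j).+1.
Proof. by apply/setP=> v; rewrite !inE !cdistE ltnS. Qed.

Lemma strings_of_lengthE l S : 0 < l <= n ->
  reflect (exists i, S = carc i l) (S \in strings_of_length n l).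
Proof.
move=> /andP[l_gt0 le_ln]; apply: (iffP imsetP) => [[[i j]]|[i ->]].
  rewrite inE /= stringE card_arc ?cdist_lt // => /eqP <- ->.
  by exists i.
have lt_l : l.-1 < n by rewrite prednK.
have strE : string i (step l.-1 i) = carc i l.
  by rewrite stringE cdist_iter // prednK.
by exists (i, step l.-1 i); rewrite ?inE /= strE ?card_arc.
Qed.

Section ArcFamily.
(** For thresholds, [F_cover] will come from codimension three, [F_convex] from exactness, and
    [F_separates] from labels not dividing one another. *)
Variable F : {set 'I_n} -> Prop.
Hypothesis n_gt1 : 1 < n.
Hypothesis F_neq0 : forall S, F S -> S != set0.
Hypothesis F_cover : forall S T, F S -> F T -> S :|: T != setT.
Hypothesis F_convex : forall S T, F S -> F T -> convex (~: (S :|: T)).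
Hypothesis F_separates :
  forall u v, u != v -> exists S, [/\ F S, u \in S & v \notin S].

(** The arc starts where [S] is entered, at [a], and ends at the first exit [l]; convexity of the
    complement forbids another entry. *)
Lemma family_arc S : F S -> exists a l, 0 < l < n /\ S = carc a l.
Proof.
move=> FS; have /set0Pn[x xS] := F_neq0 FS.
have [b bNS SbS] : exists2 b, b \notin S & ordS b \in S.
  have [/existsP[b /andP[]]|] := boolP [exists b, (b \notin S) && (ordS b \in S)].
    by exists b.
  rewrite negb_exists => /forallP noS; have := F_cover FS FS.
  rewrite setUid => /eqP[]; apply/setP=> y; rewrite inE.
  apply: contraTT xS; apply: (@cdist_ind _ (fun z => z \notin S)) => z zNS.
  by have := noS z; rewrite zNS.
pose a := ordS b; have lastE : step n.-1 a = b.
  by rewrite /a -iterSr prednK ?iter_ordS_n // ltnW.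
have exl : exists l, step l a \notin S by exists n.-1; rewrite lastE.
exists a, (ex_minn exl); case: ex_minnP => l lNS minl.
have l_gt0 : 0 < l by case: posnP lNS => // ->; rewrite /= SbS.
have le_l : l <= n.-1 by apply: minl; rewrite lastE.
split; first by lia.
apply/setP=> v; rewrite inE -{1}(iter_cdist a v); have := cdist_lt a v.
move: (cdist a v) => d lt_dn; apply/idP/idP => [dS|]; last first.
  by apply: contraLR => /minl; rewrite -leqNgt.
apply: contraTT dS; rewrite -leqNgt => le_ld.
have [->//|neq_dl] := eqVneq d l.
have [->|neq_dn] := eqVneq d n.-1; first by rewrite lastE.
(* Seen from the exit, the complement is left at [d] and met again at [b], so by convexity it would
   contain [a], one step further. *)
apply/negP=> dS; have := F_convex FS FS; rewrite setUid.
move=> /(_ (step l a) (d - l) (n.-1 - l) (n - l)); rewrite -!iterD !subnK; try lia.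
rewrite lastE iter_ordS_n !inE SbS dS bNS lNS => conv.
by have : ~~ true by apply: conv => //; lia.
Qed.

Lemma family_gap a l l' : 0 < l < n -> 0 < l' < n ->
  F (carc a l) -> F (carc (step l.+1 a) l') -> n <= (l + l').+1.
Proof.
move=> lt_l lt_l' Fl Fl'; rewrite leqNgt; apply/negP=> lt_n.
have := F_convex Fl Fl'; set W := ~: _ => convW.
have stepW t : t < n -> (step t a \in W) = ~~ (t < l) && ~~ (l < t <= l + l').
  move=> lt_tn; rewrite !inE (cdist_shift a (step _ _)) !cdist_iter //; last by lia.
  by case: ifP; lia.
(* From the vertex between the arcs, the second arc begins after one step, a vertex outside both
   follows it after [l'.+1] steps, and the first arc begins again after [n - l]. *)
have := convW (step l a) 1 l'.+1 (n - l); rewrite -!iterD subnK; last by lia.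
have aNW : a \in W = false by rewrite -[a]/(step 0 a) stepW; lia.
by rewrite iter_ordS_n aNW !stepW; lia.
Qed.

Lemma family_adjacent a l l' : 0 < l < n -> 0 < l' < n ->
  F (carc a l) -> F (carc (step l a) l') -> l + l' < n.
Proof.
move=> lt_l lt_l' Fl Fl'; rewrite ltnNge; apply: contra (F_cover Fl Fl') => le_n.
apply/eqP/setP=> x; rewrite !inE (cdist_shift a (step _ _)) cdist_iter; last by lia.
by have := cdist_lt a x; case: ifP; lia.
Qed.

Lemma neq_ordS i : i != ordS i.
Proof.
by apply/eqP=> /(congr1 (cdist i)); rewrite cdistxx -[ordS i]/(step 1 i) cdist_iter.
Qed.

(** A member that contains [i] but not its successor must end at [i]. *)
Lemma family_end i : exists a l, [/\ 0 < l < n, F (carc a l) & step l a = ordS i].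
Proof.
have [S [FS iS SiNS]] := F_separates (neq_ordS i).
have [a [l [lt_l SE]]] := family_arc FS; exists a, l; rewrite -SE; split=> //.
move: iS SiNS; rewrite SE !inE; rewrite -{2 3}(iter_cdist a i) -iterS.
have := cdist_lt a i; move: (cdist a i) => d lt_dn lt_dl.
have [->//|neq_dl] := eqVneq d.+1 l; rewrite cdist_iter; lia.
Qed.

Lemma family_start i : exists l, 0 < l < n /\ F (carc i l).
Proof.
rewrite -(ord_predK i); move: (ord_pred i) => j.
have := neq_ordS j; rewrite eq_sym => /F_separates[S [FS SjS jNS]].
have [a [l [lt_l SE]]] := family_arc FS; exists l; split=> //.
suff <- : a = ordS j by rewrite -SE.
move: SjS jNS; rewrite SE !inE -{2}(iter_cdist a (ordS j)) cdistS.
case: ifP => // _; have := cdist_lt a j.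
by move: (cdist a j) => d lt_dn; lia.
Qed.

(** A member of length [m] ending just before [i] compares the two: m + l <= n - 1 <= m + l'. *)
Lemma family_length_step i l l' : 0 < l < n -> 0 < l' < n ->
  F (carc i l) -> F (carc (ordS i) l') -> l <= l'.
Proof.
move=> lt_l lt_l'; have [a [m [lt_m Fm]]] := family_end (ord_pred i).
rewrite ord_predK => <- Fl Fl'.
have := family_adjacent lt_m lt_l Fm Fl.
by have := family_gap lt_m lt_l' Fm Fl'; lia.
Qed.

Lemma family_length_le i j l l' : 0 < l < n -> 0 < l' < n ->
  F (carc i l) -> F (carc j l') -> l <= l'.
Proof.
move=> lt_l lt_l' Fl.
have step_le t m : 0 < m < n -> F (carc (step t.+1 i) m) -> l <= m.
  elim: t m => [|t IH] m lt_m; first exact: family_length_step.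
  have [m' [lt_m' Fm']] := family_start (step t.+1 i).
  by move/(family_length_step lt_m' lt_m Fm'); apply/leq_trans/IH.
case dE: (cdist i j) => [|d].
  (* When [j] is [i] itself, go around the whole polygon. *)
  rewrite (_ : j = step n.-1.+1 i); first exact: step_le.
  by rewrite prednK ?iter_ordS_n ?(ltnW n_gt1) // -[LHS](iter_cdist i) dE.
rewrite -(iter_cdist i j) dE; exact: step_le.
Qed.

Lemma family_strings : exists r, n = (2 * r).+1 /\
  forall S, F S <-> exists i, S = carc i r.
Proof.
have [r [lt_r Fr]] := family_start (Ordinal (ltnW n_gt1)).
have lenr i l : 0 < l < n -> F (carc i l) -> l = r.
  move=> lt_l Fl; apply/eqP; rewrite eqn_leq.
  by rewrite (family_length_le lt_l lt_r Fl Fr) (family_length_le lt_r lt_l Fr Fl).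
have startr i : F (carc i r).
  by have [l [lt_l Fl]] := family_start i; rewrite -(lenr i l).
exists r; split=> [|S].
  have := family_adjacent lt_r lt_r Fr (startr _).
  by have := family_gap lt_r lt_r Fr (startr _); lia.
split=> [FS|[i ->]]; last exact: startr.
have [a [l [lt_l SE]]] := family_arc FS.
by exists a; rewrite SE (lenr a l) // -SE.
Qed.

End ArcFamily.
End Arcs.

(** * The labelling by strings of length r *)

Section ArcLabelling.
Variables (k : fieldType) (n r : nat).
Hypothesis n_odd : n = (2 * r).+1.
Hypothesis r_gt0 : 0 < r.
Implicit Types (i j u v x y p q : 'I_n) (U T Q Y : {set 'I_n}).
Local Notation step t := (iter t (@ordS n)).

Definition arc_labelling : labelling n :=
  @Labelling n n (fun v => [multinom (v \in carc p r : nat) | p < n]).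

Definition arcs_through v : {set 'I_n} := [set p | v \in carc p r].

Lemma lab_arcE v (p : 'I_n) : lab arc_labelling v p = (v \in carc p r) :> nat.
Proof. exact: mnmE. Qed.

Lemma lab_arc_mesym1 v : lab arc_labelling v = mesym1 (arcs_through v).
Proof. by apply/mnmP=> p; rewrite lab_arcE mnmE [p \in _]inE. Qed.

Lemma mem_arcs_through x p v : (p \in arcs_through v) =
  if cdist x p <= cdist x v then cdist x v - cdist x p < r
  else cdist x v + n - cdist x p < r.
Proof. by rewrite !inE (cdist_shift x p v); case: ifP. Qed.

Lemma arcs_throughE p v : (p \in arcs_through v) = (cdist p v < r).
Proof. by rewrite !inE. Qed.

(** The nonfaces for the ideal of labels in which the variables outside [Y] are set to 1. *)
Definition some_face_in Y U := [exists v, arcs_through v :&: Y \subset U].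

Lemma some_face_nonfaces Y : nonfaces (some_face_in Y).
Proof.
move=> U V /existsP[v vU]; apply/existsP; exists v.
exact: subset_trans vU (subsetUl _ _).
Qed.

(** The nonfaces after adding the variable [x]: only the vertices outside the string [x] still
    contribute generators, and these form a path. *)
Definition path_face x Y U :=
  (x \in U) || [exists v, (x \notin arcs_through v) && (arcs_through v :&: Y \subset U)].

Lemma path_face_nonfaces x Y : nonfaces (path_face x Y).
Proof.
move=> U V /orP[xU|/existsP[v /andP[xv vU]]]; rewrite /path_face.
  by rewrite inE xU.
apply/orP; right; apply/existsP; exists v; rewrite xv.
exact: subset_trans vU (subsetUl _ _).
Qed.

Local Notation good D := (wreg (mem_ideal (sqfree_ideal k D)) (esyms k n (n - 3))).

Lemma good_ext D D' : D =1 D' -> good D -> good D'.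
Proof.
move=> DD; apply: wreg_ext => h.
by rewrite /mem_ideal (sqfree_ideal_ext DD).
Qed.

Lemma good_meets T : #|T| = 3 -> good (meets T).
Proof.
move=> T3; apply: wreg_esyms.
by have := cardsC T; rewrite T3 card_ord; lia.
Qed.

Lemma subset_setI_setU1 y T Y U :
  (T :&: Y \subset y |: U) = (T :&: (Y :\ y) \subset U).
Proof.
apply/subsetP/subsetP => sub p.
  case/setIP=> pT /setD1P[py pY]; have := sub p; rewrite !inE pT pY (negPf py).
  exact.
case/setIP=> pT pY; rewrite in_setU1; case: eqVneq => //= py.
by apply: sub; rewrite !in_setI in_setD1 pT py pY.
Qed.

(* On the path obtained by deleting the string at x, the others become initial *)
(* or final segments; the longest initial segment y in Y is eliminated.        *)
Lemma good_path x Y : x \notin Y -> good (path_face x Y).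
Proof.
move: {2}#|Y| (leqnn #|Y|) => N; elim: N Y => [|N IH] Y card_Y xNY.
  move: card_Y; rewrite leqn0 cards_eq0 => /eqP Y0.
  apply: wreg_full => h; apply/midealP=> m; rewrite /path_face Y0.
  case/negP; apply/orP; right; apply/existsP; exists (step r x).
  by rewrite setI0 sub0set arcs_throughE cdist_iter; lia.
have lt_d := cdist_lt x; have dist_gt0 p : p \in Y -> 0 < cdist x p.
  by move=> pY; rewrite lt0n; apply: contraNneq xNY => d0; rewrite -(iter_cdist x p) d0 in pY.
(* The strings through the first vertex past the string [x] start at distances 1 to [r] from [x]. If
   none is in [Y], this vertex contributes the monomial 1. *)
case: (pickP [pred p in Y | cdist x p <= r]) => [p0 p0P|noY]; last first.
  apply: wreg_full => h; apply/midealP=> m.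
  case/negP; apply/orP; right; apply/existsP; exists (step r x).
  rewrite arcs_throughE cdist_iter; last by lia.
  apply/andP; split; first by lia.
  apply/subsetP=> p; rewrite inE (mem_arcs_through x) cdist_iter; last by lia.
  by case/andP=> + pY; have := noY p; have := lt_d p; rewrite /= pY /=; case: ifP; lia.
have [y /= /andP[yY le_yr] max_y] :=
  @arg_maxnP _ p0 [pred p in Y | cdist x p <= r] (cdist x) p0P.
have y_gt0 := dist_gt0 y yY; have neq_xy : x != y by apply: contraNneq xNY => ->.
(* [v0] is the first vertex past the string [y]. The strings of [Y] through it are final segments,
   so its monomial divides those of all vertices outside the strings [x] and [y]. *)
pose v0 := step (r + cdist x y) x; pose Q := arcs_through v0 :&: Y.
have v0E : cdist x v0 = r + cdist x y by rewrite cdist_iter; lia.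
have xNv0 : x \notin arcs_through v0.
  by rewrite arcs_throughE v0E; lia.
have yNv0 : y \notin arcs_through v0.
  by rewrite (mem_arcs_through x) v0E; case: ifP; lia.
apply: (@sqfree_ideal_wreg _ _ _ y); first exact: path_face_nonfaces.
  apply: (@good_ext (path_face x (Y :\ y))).
    move=> U; rewrite /path_face !inE (negPf neq_xy) /=; congr (_ || _).
    by apply: eq_existsb => v; rewrite subset_setI_setU1.
  apply: IH; first by rewrite (cardsD1 y Y) yY in card_Y; lia.
  by rewrite !inE (negPf xNY) andbF.
apply: (@good_ext (fun U => meets [set x; y] U || (Q \subset U))).
  move=> U; rewrite /path_face orbA; have -> : meets [set x; y] U = (y \in U) || (x \in U).
    apply/meetsP/orP => [[p /set2P[->|->] pU]|[yU|xU]]; [by right|by left| |].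
      by exists y; rewrite ?set22.
    by exists x; rewrite ?set21.
  case: (boolP (y \in U)) => //= yNU; case: (x \in U) => //=.
  apply/idP/existsP => [QU|[v /andP[xNv vU]]]; first by exists v0; rewrite xNv0.
  apply: (subset_trans _ vU); apply/subsetP=> q /setIP[qv0 qY]; rewrite inE qY andbT.
  have yNv : y \notin arcs_through v.
    by apply: contra yNU => yv; apply: (subsetP vU); rewrite inE yv.
  have max_q : cdist x q <= r -> cdist x q <= cdist x y.
    by move=> le_q; apply: max_y; rewrite /= qY.
  move: xNv yNv qv0; rewrite arcs_throughE !(mem_arcs_through x) v0E.
  have := lt_d q; have := lt_d v; have := lt_d y; move: max_q.
  by do 3!case: ifP; lia.
apply: wreg_meets_sub => [|q /setIP[qv0 _]].
  rewrite disjoint_sym disjoints_subset; apply/subsetP=> p.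
  by case/set2P=> ->; rewrite in_setC in_setI negb_and ?xNv0 ?yNv0.
apply: good_meets; rewrite cardsU1 cards2 neq_xy !inE.
have -> : (q == x) = false by apply: contraTF qv0 => /eqP ->.
by have -> : (q == y) = false by apply: contraTF qv0 => /eqP ->.
Qed.

(** Decompose at [x] in [Y]: the colon removes [x] from [Y], and adding the variable cuts the
    polygon open into a path. *)
Lemma good_some_face Y : good (some_face_in Y).
Proof.
move: {2}#|Y| (leqnn #|Y|) => N; elim: N Y => [|N IH] Y card_Y.
  move: card_Y; rewrite leqn0 cards_eq0 => /eqP Y0.
  apply: wreg_full => h; apply/midealP=> m; case/negP; apply/existsP.
  have n_gt0 : 0 < n by rewrite n_odd.
  by exists (Ordinal n_gt0); rewrite Y0 setI0 sub0set.
case: (set_0Vmem Y) => [Y0|[x xY]]; first by apply: IH; rewrite Y0 cards0.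
apply: (@sqfree_ideal_wreg _ _ _ x); first exact: some_face_nonfaces.
  apply: (@good_ext (some_face_in (Y :\ x))).
    by move=> U; apply: eq_existsb => v; rewrite subset_setI_setU1.
  by apply: IH; rewrite (cardsD1 x Y) xY in card_Y; lia.
apply: (@good_ext (path_face x (Y :\ x))); last first.
  by apply: good_path; rewrite !inE eqxx.
move=> U; rewrite /path_face; case: (boolP (x \in U)) => //= xNU.
apply: eq_existsb => v; have [xv|xNv] /= := boolP (x \in arcs_through v).
  apply/esym/negP => /subsetP/(_ x); rewrite inE xv xY (negPf xNU) => /(_ isT).
  by [].
suff -> : arcs_through v :&: (Y :\ x) = arcs_through v :&: Y by [].
apply/setP=> p; rewrite !in_setI in_setD1.
by case: eqP => [->|//]; rewrite (negPf xNv).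
Qed.

Lemma leq_card_bigcup (T : finType) (P : {set 'I_n}) (f : 'I_n -> {set T}) :
  #|\bigcup_(i in P) f i| <= \sum_(i in P) #|f i|.
Proof.
elim/big_rec2: _ => [|i m B _ le_m]; first by rewrite cards0.
by rewrite (leq_trans (leq_card_setU _ _)) ?leq_add2l.
Qed.

(** A transversal indexes strings that cover the polygon, and two strings have at most 2r < n
    vertices. *)
Lemma transversal_card T : (forall v, meets T (arcs_through v)) -> 3 <= #|T|.
Proof.
move=> hitT; have : #|\bigcup_(p in T) carc p r| <= #|T| * r.
  apply: (leq_trans (leq_card_bigcup _ _)); rewrite -sum_nat_const leq_sum // => p _.
  by rewrite card_arc; lia.
have -> : \bigcup_(p in T) carc p r = setT.
  apply/setP=> v; rewrite [RHS]inE; apply/bigcupP.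
  by have /meetsP[p pT] := hitT v; rewrite inE => vp; exists p.
by rewrite cardsT card_ord; nia.
Qed.

(** The strings starting at 0, r and 2r cover the polygon, the last one containing the remaining
    vertex 2r. *)
Definition base_transversal : {set 'I_n} := 
  [set p : 'I_n | (p == 0 :> nat) || (p == r :> nat) || (p == 2 * r :> nat)].

Lemma base_transversal_card : #|base_transversal| = 3.
Proof.
have lt0 : 0 < n by lia. have lt1 : r < n by lia. have lt2 : 2 * r < n by lia.
have -> : base_transversal = Ordinal lt0 |: [set Ordinal lt1; Ordinal lt2].
  by apply/setP=> p; rewrite !inE -!val_eqE /= orbA.
by rewrite cardsU1 cards2 !inE -!val_eqE /=; lia.
Qed.

Lemma base_transversal_meets v : meets base_transversal (arcs_through v).
Proof.
have lt0 : 0 < n by lia. have lt1 : r < n by lia. have lt2 : 2 * r < n by lia.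
have ltv := ltn_ord v; apply/meetsP.
have [lt_v|le_v] := ltnP v r.
  by exists (Ordinal lt0); rewrite !inE /cdist /= ?subn0.
have [lt_v2|le_v2] := ltnP v (2 * r).
  by exists (Ordinal lt1); rewrite !inE /cdist /= ?eqxx ?orbT // le_v; lia.
by exists (Ordinal lt2); rewrite !inE /cdist /= ?eqxx ?orbT // le_v2; lia.
Qed.

End ArcLabelling.

Arguments lab : simpl never.

(** * The labelling by strings is an object of the category *)

Section ArcLabellingCM.
Variables (k : fieldType) (n r : nat).
Hypothesis n_odd : n = (2 * r).+1.
Hypothesis r_gt0 : 0 < r.
Implicit Types (i j u v x y p q : 'I_n) (U T Q Y : {set 'I_n}).
Local Notation step t := (iter t (@ordS n)).
Local Notation L := (arc_labelling n r).

Let arc_mnms := [seq lab L v | v <- enum 'I_n].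

Lemma lab_gens_arc : lab_gens k L = [seq 'X_[k, m] | m <- arc_mnms].
Proof. by rewrite -map_comp. Qed.

Lemma in_arc_ideal h :
  h \in sqfree_ideal k (some_face_in r setT) <-> in_ideal (lab_gens k L) h.
Proof.
rewrite lab_gens_arc in_ideal_monomials.
set a := (X in is_true X <-> _); set b := (X in _ <-> is_true X).
suff -> : a = b by []; apply: mideal_ext => m.
rewrite /arc_mnms has_map; apply/existsP/hasP => [[v vm]|[v _ vm]]; exists v.
- by rewrite mem_enum.
- by rewrite /= lab_arc_mesym1 mesym1_le; rewrite setIT in vm.
by rewrite setIT -mesym1_le -lab_arc_mesym1.
Qed.

Lemma arc_gens_var_ideal T : (forall v, meets T (arcs_through r v)) ->
  {in lab_gens k L, forall g, g \in var_ideal k T}.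
Proof.
move=> hitT g; rewrite lab_gens_arc => /mapP[m /mapP[v _ ->] ->].
by rewrite var_idealX lab_arc_mesym1 msupport_mesym1.
Qed.

Lemma codim_arc : codim (lab_gens k L) 3.
Proof.
rewrite lab_gens_arc -(base_transversal_card n_odd r_gt0).
apply: codim_monomials => [m /mapP[v _ ->]|U hitU].
  by rewrite lab_arc_mesym1 msupport_mesym1; apply: base_transversal_meets.
rewrite base_transversal_card //; apply: (transversal_card n_odd r_gt0) => v.
have := hitU (lab L v); rewrite lab_arc_mesym1 msupport_mesym1; apply.
by rewrite -lab_arc_mesym1; apply/map_f/mem_enum.
Qed.

Lemma card_face U : ~~ some_face_in r setT U -> #|U| + 3 <= n.
Proof.
move=> UN; have := cardsC U; rewrite card_ord.
suff : 3 <= #|~: U| by lia.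
apply: (transversal_card n_odd r_gt0) => v; apply: contraR UN => vN.
apply/existsP; exists v; rewrite setIT -[U]setCK -disjoints_subset.
by rewrite -setI_eq0 setIC; move: vN; rewrite negbK.
Qed.

Lemma size_esyms m : size (esyms k n m) = m.
Proof. by elim: m => //= m ->. Qed.

Lemma esyms_coef0 m f : f \in esyms k n m -> (f@_0%MM = 0)%R.
Proof.
elim: m => //= m IH; rewrite inE => /orP[/eqP ->|//].
by rewrite mcoeff_mesym /mechar mdeg0.
Qed.

Lemma lab_arc_neq0 v : lab L v != 0%MM.
Proof.
apply/eqP=> /mnmP/(_ v); rewrite mnm0E lab_arcE inE cdistxx => /eqP.
by rewrite eqb0 r_gt0.
Qed.

Lemma cohen_macaulay_arc : cohen_macaulay (lab_gens k L).
Proof.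
have gens_in := arc_gens_var_ideal (base_transversal_meets n_odd r_gt0).
exists (n - 3).
  rewrite -[n - 3]size_esyms; apply: (depth_sqfree _ in_arc_ideal).
  - by move=> U /card_face; rewrite size_esyms leq_subRL 1?addnC //; lia.
  - move=> g; rewrite lab_gens_arc => /mapP[m /mapP[v _ ->] ->].
    by rewrite mcoeffX (negPf (lab_arc_neq0 v)).
  - by move=> f; apply: esyms_coef0.
  exact: good_some_face.
rewrite -(base_transversal_card n_odd r_gt0).
apply: (krull_dim_sqfree _ in_arc_ideal) => // U /card_face.
by rewrite base_transversal_card.
Qed.

(** If the set alternated, strings through the missing vertices at [a] and [c] with exponent 0 in
    [u] would be disjoint and avoid the vertices at 0 and [b], making 2r + 2 vertices. *)
Lemma dividing_arc_convex (u : 'X_{1..lvars L}) : convex (dividing L u).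
Proof.
move=> x a b c lt_abc lt_cn xW aNW bW; apply: contraT => cNW.
have arcW p (w : 'I_n) : u p = 0 -> w \in dividing L u -> r <= cdist p w.
  move=> up0; rewrite inE leqNgt => /mnm_lepP/(_ p).
  by rewrite up0 lab_arcE leqn0 eqb0 inE.
have missing (w : 'I_n) : w \notin dividing L u -> exists p, u p = 0 /\ cdist p w < r.
  rewrite inE => /mnm_lepP Nle; suff /existsP[p /andP[/eqP up pw]] :
      [exists p, (u p == 0) && (cdist p w < r)] by exists p.
  apply: contraT; rewrite negb_exists => /forallP noP; case: Nle => p.
  rewrite lab_arcE inE; have := noP p; rewrite negb_and -lt0n.
  by case: (cdist p w < r); rewrite ?orbF.
have [p [up pa]] := missing _ aNW; have [q [uq qc]] := missing _ cNW.
have := arcW p _ up xW; have := arcW p _ up bW.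
have := arcW q _ uq xW; have := arcW q _ uq bW.
move: pa qc; rewrite !(cdist_shift x p) !(cdist_shift x q) cdistxx.
have := cdist_lt x p; have := cdist_lt x q; rewrite !cdist_iter; try lia.
by do !case: ifP; lia.
Qed.

(** For incident faces some string meets the larger and misses the smaller, so its variable divides
    the quotient of the labels. *)
Lemma cellular_minimal_arc : cellular_minimal k (polygon n) L.
Proof.
have wit d (G : cell (polygon n) d) (F : cell (polygon n) d.+1) (p v : 'I_n) :
    v \in verts F -> v \in carc p r ->
    {in verts G, forall w : 'I_n, w \notin carc p r} -> ((bd_coef k L G F)@_0%MM = 0)%R.
  move=> vF vp Gp; rewrite /bd_coef mulrzl raddfMz /= mcoeffX.
  case: eqP => [m0|_]; last by rewrite mul0rz.
  have FE := @face_labE n (polygon n) L _ F p.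
  have GE := @face_labE n (polygon n) L _ G p.
  have : face_lab L F p - face_lab L G p = 0.
    by have := congr1 (fun m : 'X_{1..lvars L} => m p) m0; rewrite mnmBE mnm0E.
  rewrite FE GE [X in _ - X]big1 => [|w /Gp]; last first.
    by rewrite lab_arcE => /negPf ->.
  rewrite subn0 => max0.
  have /bigmax_leqP/(_ v vF) : \max_(w in verts F) lab L w p <= 0 by rewrite max0.
  by rewrite lab_arcE vp.
have zero d (G : cell (polygon n) d) (F : cell (polygon n) d.+1) :
    sign G F = 0%R -> ((bd_coef k L G F)@_0%MM = 0)%R.
  by rewrite /bd_coef => ->; rewrite mul0r mcoeff0.
move=> [|[|[|d]]] // G F.
- apply: (@wit 0 _ _ F F); rewrite ?set11 // ?inE ?cdistxx //.
  by move=> w; rewrite inE.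
- have [->|neq_GF] := eqVneq (G : 'I_n) F.
    apply: (@wit 1 _ _ (ordS F) (ordS F)); rewrite ?set22 // ?inE ?cdistxx //.
    move=> w /set1P ->; rewrite inE (cdist_shift F) cdistxx.
    by rewrite -[ordS F]/(step 1 F) cdist_iter ?ltnn; lia.
  have [->|neq_GS] := eqVneq G (ordS F); last first.
    by apply: zero; rewrite /= (negPf neq_GF) (negPf neq_GS).
  (* The string ending at [F]: going [n - r.-1] steps forward amounts to [r.-1] steps back. *)
  pose p := step (n - r.-1) F; have pF : step r.-1 p = F.
    by rewrite -iterD subnKC ?iter_ordS_n //; lia.
  apply: (@wit 1 _ _ p F); first by rewrite set21.
    by rewrite inE -pF cdist_iter; lia.
  move=> w /set1P ->; rewrite inE -pF -iterS prednK // cdist_iter; last by lia.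
  by rewrite ltnn.
(* The string starting just past the edge [G] ends at distance [r.+1] < n and so misses the edge. *)
pose p := step 2 G; have pE : cdist G p = 2 by rewrite cdist_iter; lia.
apply: (@wit 2 _ _ p p); rewrite ?inE ?cdistxx //.
have SGE : cdist G (ordS G) = 1 by rewrite -[ordS G]/(step 1 G) cdist_iter; lia.
by move=> w /set2P[] ->; rewrite inE (cdist_shift G) pE ?cdistxx ?SGE /=; lia.
Qed.

(** If [v] lies in the string starting at [u], then the string ending at [u] misses it. *)
Lemma arc_antichain (u v : 'I_n) : u != v -> ~~ (lab L u <= lab L v)%MM.
Proof.
move=> neq_uv; have lt_d := cdist_lt u v.
have d_gt0 : 0 < cdist u v.
  by rewrite lt0n; apply: contraNneq neq_uv => d0; rewrite -(iter_cdist u v) d0.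
suff [p pu pv] : exists2 p, cdist p u < r & r <= cdist p v.
  by apply/negP=> /mnm_lepP/(_ p); rewrite !lab_arcE !inE pu ltnNge pv.
have [le_rd|lt_dr] := leqP r (cdist u v); first by exists u; rewrite ?cdistxx.
pose p := step (n - r.-1) u; have pu : step r.-1 p = u.
  by rewrite -iterD subnKC ?iter_ordS_n //; lia.
have pv : step (cdist u v + r.-1) p = v by rewrite iterD pu iter_cdist.
exists p; first by rewrite -pu cdist_iter; lia.
by rewrite -pv cdist_iter; lia.
Qed.

Lemma CM_arc : CM k (polygon n) L.
Proof.
have n_gt2 : 2 < n by lia.
split; [exact: arc_antichain|exact: cohen_macaulay_arc|exact: codim_arc| |].
  by apply: connected_resolution => // u; apply/convex_connect/dividing_arc_convex.
exact: cellular_minimal_arc.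
Qed.

End ArcLabellingCM.

(** * Thresholds of an arbitrary object *)

Section Thresholds.
Variables (k : fieldType) (n : nat) (A : labelling n).
Hypothesis n_gt2 : 2 < n.
Hypothesis cmA : CM k (polygon n) A.
Implicit Types (u v : 'I_n) (p q : 'I_(lvars A)) (S T : {set 'I_n}).

Definition threshold p t : {set 'I_n} := [set v | t < lab A v p].

Definition is_threshold S := S != set0 /\ exists p t, S = threshold p t.

(** If they covered the polygon, the prime generated by the two variables would contain all labels,
    and the codimension would be at most two. *)
Lemma threshold_cover S T : is_threshold S -> is_threshold T -> S :|: T != setT.
Proof.
case=> _ [p [t ->]] [_ [q [t' ->]]]; apply/eqP=> cover.
case: cmA => _ _ codim3 _ _.
have /codim_le/(_ codim3) : {in lab_gens k A, forall g, g \in var_ideal k [set p; q]}.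
  move=> g /mapP[v _ ->]; rewrite var_idealX; apply/meetsP.
  have : v \in threshold p t :|: threshold q t' by rewrite cover in_setT.
  rewrite !inE => /orP[lt_t|lt_t].
    by exists p; rewrite ?set21 // inE (leq_ltn_trans (leq0n _) lt_t).
  by exists q; rewrite ?set22 // inE (leq_ltn_trans (leq0n _) lt_t).
by rewrite cards2; case: (p != q).
Qed.

Lemma threshold_convex S T :
  is_threshold S -> is_threshold T -> convex (~: (S :|: T)).
Proof.
case=> _ [p [t ->]] [_ [q [t' ->]]]; case: cmA => _ _ _ res _.
pose B x := \max_v lab A v x.
(* Exponents other than those at [p] and [q] are large enough to impose nothing; the minimum also
   handles p = q. *)
pose u := [multinom minn (if x == p then t else B x) (if x == q then t' else B x)
            | x < lvars A].
have leB v x : lab A v x <= B x by rewrite /B (bigD1 v) //= leq_maxl.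
have <- : dividing A u = ~: (threshold p t :|: threshold q t').
  apply/setP=> v; rewrite !inE negb_or -!leqNgt.
  apply/mnm_lepP/andP => [le_u|[le_t le_t'] x]; last first.
    by rewrite mnmE leq_min; apply/andP; split; case: eqP => [->|_].
  have := le_u p; have := le_u q; rewrite !mnmE !eqxx !leq_min.
  by case/andP=> _ -> /andP[->].
by apply: connect_convex; apply: (resolution_connected n_gt2 res).
Qed.

Lemma threshold_separates u v : u != v ->
  exists S, [/\ is_threshold S, u \in S & v \notin S].
Proof.
case: cmA => antichain _ _ _ _ /antichain.
rewrite negb_forall => /existsP[p]; rewrite -ltnNge => lt_p.
have uS : u \in threshold p (lab A v p) by rewrite inE.
exists (threshold p (lab A v p)); split=> //; last by rewrite inE ltnn.
by split; [apply/set0Pn; exists u|exists p, (lab A v p)].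
Qed.

Lemma threshold_arcs : exists r, n = (2 * r).+1 /\
  forall S, is_threshold S <-> exists i, S = carc i r.
Proof.
apply: family_strings; first exact: ltnW.
- by move=> S [].
- exact: threshold_cover.
- exact: threshold_convex.
exact: threshold_separates.
Qed.

Variable r : nat.
Hypothesis n_odd : n = (2 * r).+1.

Lemma is_thresholdE S : is_threshold S <-> exists i, S = carc i r.
Proof. by have [r' [nE arcE]] := threshold_arcs; have -> : r = r' by lia. Qed.

Definition weight p := \max_v lab A v p.

Lemma var_set_arc p : var_set p != set0 -> exists i, var_set p = carc i r.
Proof. by move=> p0; apply/is_thresholdE; split=> //; exists p, 0. Qed.

(** The string is a threshold of some variable, hence contained in that variable's [var_set], which
    is a string of the same length. *)
Lemma arc_var_set i : exists p, var_set p = carc i r.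
Proof.
have /is_thresholdE[/set0Pn[v vi] [p [t iE]]] : exists j, carc i r = carc j r by exists i.
exists p; have [|j jE] := @var_set_arc p.
  by apply/set0Pn; exists v; move: vi; rewrite iE !inE; apply: leq_ltn_trans.
rewrite jE; congr carc; apply/esym/(@arc_sub_inj _ r); first by lia.
rewrite -jE iE; apply/subsetP=> w; rewrite !inE; exact: leq_ltn_trans.
Qed.

(* All thresholds of one variable are strings of one length, hence equal.     *)
Lemma lab_weight v p : lab A v p = (v \in var_set p) * weight p.
Proof.
have le_w w : lab A w p <= weight p by rewrite /weight (bigD1 w) //= leq_maxl.
case: (boolP (v \in var_set p)) => [vp|]; last by rewrite inE -leqNgt leqn0 => /eqP.
rewrite mul1n; apply/eqP; rewrite eqn_leq le_w leqNgt /=; apply/negP=> lt_w.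
have card_gt0 : 0 < #|'I_n| by rewrite card_ord; lia.
have [w wE] := eq_bigmax (fun w => lab A w p) card_gt0; rewrite -/(weight p) in wE.
have [|i iE] := @var_set_arc p; first by apply/set0Pn; exists v.
have [j jE] : exists j, threshold p (lab A v p) = carc j r.
  apply/is_thresholdE; split; last by exists p, (lab A v p).
  by apply/set0Pn; exists w; rewrite inE -wE.
have ji : j = i.
  apply: (@arc_sub_inj _ r); first by lia.
  by rewrite -iE -jE; apply/subsetP=> x; rewrite !inE; apply: leq_ltn_trans.
by move: vp; rewrite iE -ji -jE inE ltnn.
Qed.

End Thresholds.

(** * Morphisms *)

Lemma morphism_coord n (A B : labelling n) phi u q : @morphism n A B phi ->
  phi u q = \sum_p u p * phi U_(p)%MM q.
Proof.
case=> phi0 phiD _.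
have phiM p e : phi (U_(p) *+ e)%MM q = e * phi U_(p)%MM q.
  elim: e => [|e IH]; first by rewrite mulm0n phi0 mnm0E.
  by rewrite mulmS phiD mnmDE IH mulSn.
rewrite {1}[u]multinomUE_id.
rewrite (@big_morph _ _ (fun m => phi m q) 0 addn 0%MM (@mnm_add _)).
- by apply: eq_bigr => p _; rewrite phiM.
- by move=> m m'; rewrite phiD mnmDE.
by rewrite phi0 mnm0E.
Qed.

Section Canonical.
Variables (k : fieldType) (n r : nat) (B : labelling n).
Hypothesis n_odd : n = (2 * r).+1.
Hypothesis r_gt0 : 0 < r.
Hypothesis cmB : CM k (polygon n) B.
Local Notation L := (arc_labelling n r).
Implicit Types (i j v : 'I_n) (p q : 'I_(lvars B)).

Let n_gt2 : 2 < n. Proof. by lia. Qed.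
Let r_lt : 0 < r < n. Proof. by lia. Qed.

Let carc_inj : injective (fun i : 'I_n => carc i r).
Proof. by move=> i j ij; apply: (@arc_sub_inj _ r) => //; rewrite ij. Qed.

(** The variable of a string goes to the product of the [x_p] whose [var_set] is that string, each
    raised to its weight; every coordinate is a sum of at most one term. *)
Definition from_arcs (a : 'X_{1..lvars L}) : 'X_{1..lvars B} :=
  [multinom \sum_(i < n | var_set p == carc i r) a i * weight p | p < lvars B].

Lemma from_arcsE a p i : var_set p = carc i r -> from_arcs a p = a i * weight p.
Proof.
move=> pE; rewrite mnmE (big_pred1 i) // => j.
by rewrite pE (inj_eq carc_inj) eq_sym.
Qed.

Lemma from_arcs_notin a p : (forall i, var_set p != carc i r) -> from_arcs a p = 0.
Proof. by move=> pN; rewrite mnmE big_pred0 // => i; rewrite (negPf (pN i)). Qed.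

Lemma from_arcs_morphism : @morphism n L B from_arcs.
Proof.
split.
- by apply/mnmP=> p; rewrite mnmE mnm0E big1 // => i _; rewrite mnm0E mul0n.
- move=> u v; apply/mnmP=> p; rewrite mnmDE !mnmE -big_split.
  by apply: eq_bigr => i _; rewrite mnmDE mulnDl.
move=> v; apply/mnmP=> p; rewrite (lab_weight n_gt2 cmB n_odd).
have [p0|/(var_set_arc n_gt2 cmB n_odd)[i iE]] := eqVneq (var_set p) set0.
  rewrite p0 inE mul0n from_arcs_notin // => i; rewrite p0 eq_sym.
  by apply/set0Pn; exists i; rewrite inE cdistxx.
by rewrite (from_arcsE _ iE) lab_arcE iE.
Qed.

(* The coordinates of phi are nonnegative, so 1_(arc i) can be a combination  *)
(* of strings of the same length only if all of them are equal to arc i.      *)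
Lemma from_arcsK phi : @morphism n B L phi -> cancel from_arcs phi.
Proof.
move=> morphi a; have [_ _ phi_lab] := morphi.
pose y p i := weight p * phi U_(p)%MM i.
have sum_y v i : \sum_p (v \in var_set p) * y p i = (v \in carc i r).
  rewrite -(lab_arcE r v i) -phi_lab (morphism_coord _ _ morphi).
  by apply: eq_bigr => p _; rewrite /y mulnA -(lab_weight n_gt2 cmB n_odd).
have y0 p i : var_set p != carc i r -> y p i = 0.
  have [p0 _|/(var_set_arc n_gt2 cmB n_odd)[j jE]] := eqVneq (var_set p) set0.
    rewrite /y /weight big1 ?mul0n // => v _.
    by rewrite (lab_weight n_gt2 cmB n_odd) p0 inE.
  (* At a vertex of the string [j] outside the string [i] the sum is zero, and so is each of its
     nonnegative terms. *)
  rewrite jE => ji; have /subsetPn[v vj vi] : ~~ (carc j r \subset carc i r).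
    by apply: contra ji => /(arc_sub_inj r_lt) ->.
  have /eqP := sum_y v i; rewrite (negPf vi) sum_nat_eq0 => /forallP/(_ p).
  by rewrite jE vj mul1n => /eqP.
have y1 i : \sum_(p | var_set p == carc i r) y p i = 1.
  have <- : \sum_p (i \in var_set p) * y p i = 1 by rewrite sum_y inE cdistxx r_gt0.
  rewrite [RHS](bigID (fun p => var_set p == carc i r)) /= [X in _ + X]big1 ?addn0.
    by apply: eq_bigr => p /eqP ->; rewrite inE cdistxx r_gt0 mul1n.
  by move=> p pN; rewrite y0 // muln0.
apply/mnmP=> i; rewrite (morphism_coord _ _ morphi).
have -> : a i = \sum_(p | var_set p == carc i r) a i * y p i.
  by rewrite -big_distrr /= y1 muln1.
rewrite [LHS](bigID (fun p => var_set p == carc i r)) /= [X in _ + X]big1 ?addn0.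
  by apply: eq_bigr => p /eqP pE; rewrite (from_arcsE _ pE) /y mulnA.
move=> p pN; rewrite mnmE big_distrl big1 //= => j _.
by rewrite -mulnA -/(y p i) y0 // muln0.
Qed.

Lemma iso_arc_labelling phi : @morphism n B L phi -> cancel phi from_arcs ->
  isomorphic B L.
Proof.
move=> morphi phiK; exists phi, from_arcs; split=> //.
  exact: from_arcs_morphism.
exact: from_arcsK.
Qed.

End Canonical.

(** * Uniqueness and maximality of the string labelling *)

Section Main.
Variables (k : fieldType) (n r : nat).
Hypothesis n_odd : n = (2 * r).+1.
Hypothesis r_gt0 : 0 < r.
Local Notation L := (arc_labelling n r).

Let n_gt2 : 2 < n. Proof. by lia. Qed.
Let r_lt : 0 < r < n. Proof. by lia. Qed.

Lemma var_set_arc_labelling (p : 'I_(lvars L)) : var_set p = carc p r.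
Proof. by apply/setP=> v; rewrite inE lab_arcE lt0b. Qed.

Lemma arc_labelling_maximal : maximal k (polygon n) L.
Proof.
split=> [|B phi cmB morphi]; first exact: CM_arc.
have fromK := from_arcsK n_odd r_gt0 cmB morphi.
split=> [a|]; first by exists (from_arcs B a).
by exists (from_arcs B) => //; apply: from_arcs_morphism n_odd r_gt0 cmB.
Qed.

(** Maximality of [B] splits [from_arcs], and by [from_arcsK] the splitting is a two-sided
    inverse. *)
Lemma maximal_isomorphic (B : labelling n) :
  maximal k (polygon n) B -> isomorphic B L.
Proof.
case=> cmB /(_ L (from_arcs B) (CM_arc k n_odd r_gt0)).
case=> [|_ [phi morphi phiK]]; first exact: from_arcs_morphism n_odd r_gt0 cmB.
exact: (iso_arc_labelling n_odd r_gt0 cmB morphi).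
Qed.

(** Nonemptiness of each [var_set] makes it a string, and [arc_var_set] provides all strings. *)
Lemma dagger_family (B : labelling n) : CM_dagger k (polygon n) B ->
  var_family B = strings_of_length n r.
Proof.
case=> -[cmB _ _] connB; apply/setP=> S.
apply/imsetP/strings_of_lengthE => [||[i ->]]; first by lia.
  case=> p _ ->; apply: (var_set_arc n_gt2 cmB n_odd).
  by have /connB[] : var_set p \in var_family B by apply: imset_f.
by have [p pE] := arc_var_set n_gt2 cmB n_odd i; exists p.
Qed.

(** All weights are 1 and the sets are distinct, so variables correspond one to one to strings, and
    [phi] renames them. *)
Lemma dagger_isomorphic (B : labelling n) : CM_dagger k (polygon n) B ->
  isomorphic B L.
Proof.
case=> -[cmB sqB injB] connB.
have arc_of (p : 'I_(lvars B)) : exists i, var_set p = carc i r.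
  apply: (var_set_arc n_gt2 cmB n_odd).
  by have /connB[] : var_set p \in var_family B by apply: imset_f.
have weight1 (p : 'I_(lvars B)) : weight p = 1.
  have [i iE] := arc_of p.
  have : i \in var_set p by rewrite iE inE cdistxx.
  rewrite inE => lab_gt0; apply/eqP; rewrite eqn_leq; apply/andP; split.
    by apply/bigmax_leqP=> v _; apply: sqB.
  by rewrite /weight (bigD1 i) //= (leq_trans lab_gt0) // leq_maxl.
pose phi (u : 'X_{1..lvars B}) : 'X_{1..lvars L} :=
  [multinom \sum_(p | var_set p == carc i r) u p | i < n].
have phiE u p i : var_set p = carc i r -> phi u i = u p.
  by move=> pE; rewrite mnmE (big_pred1 p) // => q; rewrite -pE (inj_eq injB).
apply: (iso_arc_labelling n_odd r_gt0 cmB (phi := phi)).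
  split.
  - by apply/mnmP=> i; rewrite mnmE mnm0E big1 // => p _; rewrite mnm0E.
  - move=> u v; apply/mnmP=> i; rewrite mnmDE !mnmE -big_split.
    by apply: eq_bigr => p _; rewrite mnmDE.
  move=> v; apply/mnmP=> i; have [p pE] := arc_var_set n_gt2 cmB n_odd i.
  by rewrite (phiE _ _ _ pE) (lab_weight n_gt2 cmB n_odd) weight1 muln1 pE lab_arcE.
move=> u; apply/mnmP=> p; have [i iE] := arc_of p.
by rewrite (from_arcsE n_odd r_gt0 _ iE) weight1 muln1 (phiE _ _ _ iE).
Qed.

Lemma arc_labelling_dagger : CM_dagger k (polygon n) L.
Proof.
split; first split; [exact: CM_arc|by move=> v p; rewrite lab_arcE leq_b1| |].
  move=> p q; rewrite !var_set_arc_labelling => pq.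
  by apply: (@arc_sub_inj _ r) => //; rewrite pq.
move=> _ /imsetP[p _ ->]; rewrite var_set_arc_labelling; split.
  by apply/set0Pn; exists p; rewrite inE cdistxx.
have conn_p x : x \in carc p r -> connect (edge_in (polygon n) (carc p r)) p x.
  rewrite inE => lt_x; rewrite -(iter_cdist p x); apply: connect_arc => t le_t.
  by rewrite mem_arc_step; lia.
move=> u v up vp; apply: connect_trans (conn_p v vp).
by rewrite (sym_connect_sym (edge_in_sym _)) conn_p.
Qed.

End Main.

Theorem theorem3p5 (k : fieldType) (n : nat) (n_ge3 : 3 <= n) :
  (forall r : nat, n = 2 * r + 1 ->
     (forall A : labelling n, CM_dagger k (polygon n) A ->
        var_family A = strings_of_length n r)
     /\ exists A0 : labelling n,
        [/\ CM_dagger k (polygon n) A0,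
            forall A : labelling n, CM_dagger k (polygon n) A ->
              isomorphic A A0,
            maximal k (polygon n) A0 &
            forall A : labelling n, maximal k (polygon n) A ->
              isomorphic A A0])
  /\ (~~ odd n -> forall A : labelling n, ~ CM k (polygon n) A).
Proof.
split=> [r|even_n A cmA]; last first.
  by have [r [nE _]] := threshold_arcs n_ge3 cmA; rewrite nE /= oddM in even_n.
rewrite addn1 => nE; have r_gt0 : 0 < r by lia.
split; first by move=> A; apply: dagger_family.
exists (arc_labelling n r); split.
- exact: arc_labelling_dagger.
- by move=> A; apply: dagger_isomorphic.
- exact: arc_labelling_maximal.
by move=> A; apply: maximal_isomorphic.
Qed.
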